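(* Consider the variance reduced SQP algorithm described in the context with the constant step size $\bar\alpha_{k,s}=\alpha$, under all standing assumptions listed there (including the merit parameter assumption with $\bar k_\tau$, $\bar\tau_{\min}$). Let $\gamma\in(0,1]$ and $b<N^{\gamma}$. There exist universal constants $\mu_0\in(0,1]$ and $\nu_0\in(0,1)$ such that the following holds. Suppose $$\alpha=\frac{\mu_0 b}{(\bar\tau_{\min}L+\Gamma)N^{\gamma}}\in(0,1],\qquad z=\frac{\bar\tau_{\min}L+\Gamma}{N^{\gamma/2}},\qquad S\le\left\lfloor \frac{N^{3\gamma/2}}{\mu_0\left(b+\frac{L^2}{(\bar\tau_{\min}L+\Gamma)^2\kappa_l\zeta}\right)}\right\rfloor .$$ Define $\lambda_S=0$ and, for $s\in\{0,\dots,S-1\}$, $$\lambda_s=\lambda_{s+1}\left(\frac{\alpha^2L^2}{\kappa_l b\zeta}+\alpha z+1\right)+\frac{\alpha^2(\bar\tau_{\min}L+\Gamma)L^2}{2\kappa_l b\zeta},$$ $$\Lambda_s=\alpha-\frac{\alpha^2(\bar\tau_{\min}L+\Gamma)}{2\bar\tau_{\min}\kappa_l}-\lambda_{s+1}\frac{\alpha}{\bar\tau_{\min}\kappa_l}\left(\alpha+\frac1z\right),$$ and $\Lambda_{\min}=\min_{0\le s\le S-1}\Lambda_s$. Then $\Lambda_{\min}\ge\frac{\nu_0 b}{(\bar\tau_{\min}L+\Gamma)N^{\gamma}}$ and, for all $k\ge\bar k_\tau$, $$\mathbb{E}_{\tau_{\min}}\left[\frac{1}{(k-\bar k_\tau+1)S}\sum_{j=\bar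 k_\tau}^{k}\sum_{s=0}^{S-1}\Delta l(x_{j,s},\bar\tau_{\min},g_{j,s},d_{j,s})\right]\le\frac{(\bar\tau_{\min}L+\Gamma)N^{\gamma}\left(\mathbb{E}_{\tau_{\min}}[\phi(x_{\bar k_\tau,0},\bar\tau_{\min})]-\phi_{\inf}\right)}{(k-\bar k_\tau+1)S\nu_0 b}.$$
   Context: Problem: $\min_{x\in\mathbb{R}^n} f(x)$ s.t. $c(x)=0$, with $f=\frac1N\sum_{i=1}^N f_i$, $f_i:\mathbb{R}^n\to\mathbb{R}$, $c:\mathbb{R}^n\to\mathbb{R}^m$. Indices: $k\in\mathbb{N}=\{0,1,\dots\}$ (outer), $s\in\{0,\dots,S-1\}$ (inner). Write $g=\nabla f$, $J=\nabla c^T$ ($m\times n$ Jacobian), and $f_{k,s}=f(x_{k,s})$, $g_{k,s}=\nabla f(x_{k,s})$, $c_{k,s}=c(x_{k,s})$, $J_{k,s}=J(x_{k,s})$. Smoothness assumption: $\mathcal X\subseteq\mathbb{R}^n$ is an open convex set containing all iterates $x_{k,s}$ of any run. $f$ and $\nabla f$ are bounded over $\mathcal X$; each $f_i$ is continuously differentiable with $L$-Lipschitz gradient; each $c_i$ is continuously differentiable and bounded over $\mathcal X$, with $\gamma_i$-Lipschitz gradient, $\gamma_i>0$, and $\Gamma:=\sum_{i=1}^m\gamma_i$; $J$ is bounded over $\mathcal X$ with singular values bounded away from zero over $\mathcal X$. Matrices: $H_{k,s}\in\mathbb{R}^{n\times n}$ are symmetric, the sequence $\{H_{k,s}\}$ is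 independent of $\{\bar g_{k,s}\}$ and bounded in norm by $\kappa_H>0$, and there is $\zeta>0$ with $u^TH_{k,s}u\ge\zeta\|u\|_2^2$ whenever $J_{k,s}u=0$. Gradient estimates: with a random mini-batch $I_{k,s}\subset\{1,\dots,N\}$ of size $b\in\{1,\dots,N-1\}$, $\tilde g_{k,s}=\frac1b\sum_{i\in I_{k,s}}\nabla f_i(x_{k,s})$ and $\bar g_{k,s}=\frac1b\sum_{i\in I_{k,s}}\left(\nabla f_i(x_{k,s})-(\nabla f_i(x_{k,0})-\nabla f(x_{k,0}))\right)$. $\mathbb{E}_{k,s}$ is expectation conditioned on the algorithm having reached $x_{k,0}$ and $x_{k,s}$ (and, where the merit parameter assumption below is in force, also on the event $E_{\tau_{\min}}$). Assumed: $\mathbb{E}_{k,s}[\tilde g_{k,s}]=g_{k,s}$, hence $\mathbb{E}_{k,s}[\bar g_{k,s}]=g_{k,s}$, and $\mathbb{E}_{k,s}[\|\bar g_{k,s}-g_{k,s}\|_2^2]\le M_{k,s}:=\frac{L^2}{b}\|x_{k,s}-x_{k,0}\|_2^2$. Merit function: $\phi(x,\tau)=\tau f(x)+\|c(x)\|_1$. For $d$ with $c(x)+\nabla c(x)^Td=0$: $\Delta l(x,\tau,g,d)=-\tau g^Td+\|c(x)\|_1$. Algorithm: inputs $x_{-1,S}$, $\bar\tau_{-1,S-1}>0$, $\epsilon_\tau,\sigma\in(0,1)$, $b$, $S\ge1$. For each $k$: $x_{k,0}=x_{k-1,S}$, $\bar\tau_{k,-1}=\bar\tau_{k-1,S-1}$.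 For each $s$: form $\bar g_{k,s}$ and solve $\begin{bmatrix}H_{k,s}&J_{k,s}^T\\ J_{k,s}&0\end{bmatrix}\begin{bmatrix}\bar d_{k,s}\\ \bar y_{k,s}\end{bmatrix}=-\begin{bmatrix}\bar g_{k,s}\\ c_{k,s}\end{bmatrix}$. If $\bar d_{k,s}=0$, set $x_{k,s+1}=x_{k,s}$, $\bar\tau_{k,s}=\bar\tau_{k,s-1}$ and go to the next inner iteration. Otherwise let $q=\bar g_{k,s}^T\bar d_{k,s}+\max\{\bar d_{k,s}^TH_{k,s}\bar d_{k,s},0\}$; set $\bar\tau^{trial}_{k,s}=\infty$ if $q\le0$ and $\bar\tau^{trial}_{k,s}=(1-\sigma)\|c_{k,s}\|_1/q$ otherwise; set $\bar\tau_{k,s}=\bar\tau_{k,s-1}$ if $\bar\tau_{k,s-1}\le\bar\tau^{trial}_{k,s}$ and $\bar\tau_{k,s}=(1-\epsilon_\tau)\bar\tau^{trial}_{k,s}$ otherwise. Choose the step size $\bar\alpha_{k,s}$ and set $x_{k,s+1}=x_{k,s}+\bar\alpha_{k,s}\bar d_{k,s}$. Constant step size option: $\bar\alpha_{k,s}=\alpha\in(0,1]$. Deterministic counterparts: $(d_{k,s},y_{k,s})$ solves the same linear system with $\bar g_{k,s}$ replaced by $g_{k,s}$; $\tau^{trial}_{k,s}$ is defined like $\bar\tau^{trial}_{k,s}$ with $(\bar g_{k,s},\bar d_{k,s})$ replaced by $(g_{k,s},d_{k,s})$. Merit parameter assumption: the event $E_{\tau_{\min}}$ occurs that there exist $\bar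 k_\tau\in\mathbb{N}$ and $\bar\tau_{\min}>0$ with $\bar\tau_{k,s}=\bar\tau_{\min}\le\tau^{trial}_{k,s}$ for all $k\ge\bar k_\tau$ and all $s\in\{0,\dots,S-1\}$; moreover the unbiasedness above holds conditionally on $E_{\tau_{\min}}$. $\mathbb{E}_{\tau_{\min}}$ denotes total expectation conditioned on this assumption. $\phi_{\inf}:=\inf_{x\in\mathcal X}\phi(x,\bar\tau_{\min})>-\infty$. $\kappa_l>0$ is a constant (it exists by a preliminary lemma of the paper) such that $\Delta l(x_{k,s},\bar\tau_{k,s},g_{k,s},d_{k,s})\ge\kappa_l\bar\tau_{k,s}\|d_{k,s}\|_2^2$ and $\Delta l(x_{k,s},\bar\tau_{k,s},\bar g_{k,s},\bar d_{k,s})\ge\kappa_l\bar\tau_{k,s}\|\bar d_{k,s}\|_2^2$ for all $(k,s)$. ''Universal'' constants are independent of $N$, $k$ and $s$. *)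

(* Defs.v *)
From HB Require Import structures.
From mathcomp Require Import all_boot all_order all_algebra.
From mathcomp Require Import all_classical all_reals all_analysis.

Set Implicit Arguments.
Unset Strict Implicit.
Unset Printing Implicit Defensive.

Import Order.TTheory GRing.Theory Num.Theory.
Import numFieldNormedType.Exports.

Local Open Scope classical_set_scope.
Local Open Scope ring_scope.

(* Vectors are rows. The library norm on ['rV[R]_n] is the maximum norm, so the
   Euclidean and l1 norms are defined here. *)
Section Vectors.
Context {R : realType}.

Definition dotv n (u v : 'rV[R]_n) : R := \sum_(i < n) u 0 i * v 0 i.

Definition norm2 n (u : 'rV[R]_n) : R := Num.sqrt (dotv u u).

Definition norm1 n (u : 'rV[R]_n) : R := \sum_(i < n) `|u 0 i|.

Definition opnorm_le n (A : 'M[R]_n) (K : R) : Prop :=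
  forall u : 'rV[R]_n, norm2 (u *m A) <= K * norm2 u.

(* [u] and [v] are a left and a right singular vector. A rectangular matrix of
   full rank does not have the singular value 0 in this sense. *)
Definition singular_value m n (A : 'M[R]_(m, n)) (sv : R) : Prop :=
  0 <= sv /\ exists (u : 'rV[R]_m) (v : 'rV[R]_n),
    [/\ u != 0, v != 0, u *m A = sv *: v & v *m A^T = sv *: u].

Definition grad n (f : 'rV[R]_n -> R) (x : 'rV[R]_n) : 'rV[R]_n :=
  \row_(j < n) 'D_(delta_mx 0 j) f x.

Definition C1_on n (X : set 'rV[R]_n) (f : 'rV[R]_n -> R) : Prop :=
  forall x, X x -> differentiable f x /\ {for x, continuous (grad f)}.

Definition lipschitz2_on n (X : set 'rV[R]_n) (K : R)
    (F : 'rV[R]_n -> 'rV[R]_n) : Prop :=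
  forall x y, X x -> X y -> norm2 (F x - F y) <= K * norm2 (x - y).

End Vectors.

Section Conditioning.
Context {d : measure_display} {T : measurableType d} {R : realType}.

Definition measurable_mx m n (Y : T -> 'M[R]_(m, n)) : Prop :=
  forall i j, measurable_fun setT (fun w => Y w i j).

(* The sigma-algebra generated by the entries of a random matrix. *)
Definition sigma_mx m n (Y : T -> 'M[R]_(m, n)) : set (set T) :=
  <<s \bigcup_(ij in [set: 'I_m * 'I_n])
        preimage_set_system setT (fun w => Y w ij.1 ij.2) measurable >>.

(* The conditional probability P( . | E). The second argument of [mnormalize]
   is its value when P(E) = 0. *)
Definition cond_prob (P : probability T R) (E : set T) (mE : measurable E) :
    probability T R :=
  mnormalize (mrestr P mE) P.

(* [Z] is a version of the conditional expectation of [Y] given [G]. *)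
Definition is_cexp (Q : probability T R) (G : set (set T)) (Y Z : T -> R) :
    Prop :=
  [/\ Q.-integrable setT (EFin \o Y),
      Q.-integrable setT (EFin \o Z),
      (forall B : set R, measurable B -> G (Z @^-1` B)) &
      forall A, G A ->
        (\int[Q]_(w in A) (Y w)%:E = \int[Q]_(w in A) (Z w)%:E)%E].

(* [G1] and [G2] are conditionally independent given [G]: the conditional
   probability of an intersection is the product of those of the factors. *)
Definition cond_indep (Q : probability T R) (G G1 G2 : set (set T)) : Prop :=
  forall A1 A2, G1 A1 -> G2 A2 -> exists q1 q2 : T -> R,
    [/\ is_cexp Q G \1_A1 q1, is_cexp Q G \1_A2 q2 &
        is_cexp Q G \1_(A1 `&` A2) (q1 \* q2)].

End Conditioning.

Record problem (R : realType) (n m N : nat) := Problem {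
  comp : 'I_N -> 'rV[R]_n -> R;
  constr : 'rV[R]_n -> 'rV[R]_m
}.

(* The sequences of one random run, indexed by the outer iteration k and the
   inner iteration s. [dbar], [ybar] are computed from the gradient estimate and
   [dtrue], [ytrue] are the deterministic counterparts. *)
Record run (R : realType) (T : Type) (n m N : nat) := Run {
  xit : nat -> nat -> T -> 'rV[R]_n;
  taubar : nat -> nat -> T -> R;
  Hmat : nat -> nat -> T -> 'M[R]_n;
  batch : nat -> nat -> T -> {set 'I_N};
  dbar : nat -> nat -> T -> 'rV[R]_n;
  ybar : nat -> nat -> T -> 'rV[R]_m;
  dtrue : nat -> nat -> T -> 'rV[R]_n;
  ytrue : nat -> nat -> T -> 'rV[R]_m
}.

Section Problem.
Context {R : realType} {n m N : nat} (p : problem R n m N).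

Definition objective (x : 'rV[R]_n) : R := N%:R^-1 * \sum_(i < N) comp p i x.

Definition constr_i (i : 'I_m) (x : 'rV[R]_n) : R := constr p x 0 i.

Definition jac (x : 'rV[R]_n) : 'M[R]_(m, n) :=
  \matrix_(i < m, j < n) grad (constr_i i) x 0 j.

Definition merit (x : 'rV[R]_n) (tau : R) : R :=
  tau * objective x + norm1 (constr p x).

Definition delta_l (x : 'rV[R]_n) (tau : R) (g dir : 'rV[R]_n) : R :=
  - tau * dotv g dir + norm1 (constr p x).

Record smoothness (X : set 'rV[R]_n) (L : R) (gam : 'I_m -> R) : Prop := {
  X_open : open X;
  X_convex : convex_set X;
  f_bounded : [bounded objective x | x in X];
  gradf_bounded : [bounded grad objective x | x in X];
  f_C1 : forall i, C1_on X (comp p i);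
  f_lipschitz : forall i, lipschitz2_on X L (grad (comp p i));
  c_C1 : forall i, C1_on X (constr_i i);
  c_bounded : forall i, [bounded constr_i i x | x in X];
  c_lipschitz : forall i, lipschitz2_on X (gam i) (grad (constr_i i));
  J_bounded : [bounded jac x | x in X];
  J_singular_values : exists2 eps : R, 0 < eps &
    forall x sv, X x -> singular_value (jac x) sv -> eps <= sv
}.

(* The system with matrix [H J^T; J 0], transposed because vectors are rows;
   H is symmetric. *)
Definition kkt (H : 'M[R]_n) (x g dir : 'rV[R]_n) (y : 'rV[R]_m) : Prop :=
  row_mx dir y *m block_mx H (jac x)^T (jac x) 0 = - row_mx g (constr p x).

Definition tau_trial (sigma : R) (H : 'M[R]_n) (x g dir : 'rV[R]_n) : \bar R :=
  let q := dotv g dir + Num.max (dotv (dir *m H) dir) 0 in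
  if q <= 0 then +oo%E else ((1 - sigma) * norm1 (constr p x) / q)%:E.

Definition tau_update (eps_tau tau : R) (trial : \bar R) : R :=
  if (tau%:E <= trial)%E then tau else (1 - eps_tau) * fine trial.

End Problem.

Section Algorithm.
Context {R : realType} {n m N : nat} (p : problem R n m N).
Context {T : Type} (r : run R T n m N).

Definition gtrue k s w : 'rV[R]_n := grad (objective p) (xit r k s w).

Definition gtilde (b : nat) k s w : 'rV[R]_n :=
  b%:R^-1 *: \sum_(i in batch r k s w) grad (comp p i) (xit r k s w).

Definition gbar (b : nat) k s w : 'rV[R]_n :=
  b%:R^-1 *: \sum_(i in batch r k s w)
    (grad (comp p i) (xit r k s w)
     - (grad (comp p i) (xit r k 0 w) - gtrue k 0 w)).

(* The merit parameter before inner iteration (k, s). *)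
Definition tau_prev (tau_in : R) (S k s : nat) w : R :=
  if s is s'.+1 then taubar r k s' w
  else if k is k'.+1 then taubar r k' S.-1 w else tau_in.

Record vr_sqp (x_in : 'rV[R]_n) (tau_in eps_tau sigma alpha : R) (b S : nat) :
    Prop := {
  batch_size : forall k s w, (s < S)%N -> #|batch r k s w| = b;
  x_init : forall w, xit r 0 0 w = x_in;
  x_outer : forall k w, xit r k.+1 0 w = xit r k S w;
  bar_kkt : forall k s w, (s < S)%N ->
    kkt p (Hmat r k s w) (xit r k s w) (gbar b k s w)
      (dbar r k s w) (ybar r k s w);
  bar_tau : forall k s w, (s < S)%N ->
    taubar r k s w =
      if dbar r k s w == 0 then tau_prev tau_in S k s w
      else tau_update eps_tau (tau_prev tau_in S k s w)
             (tau_trial p sigma (Hmat r k s w) (xit r k s w)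
                (gbar b k s w) (dbar r k s w));
  x_inner : forall k s w, (s < S)%N ->
    xit r k s.+1 w =
      if dbar r k s w == 0 then xit r k s w
      else xit r k s w + alpha *: dbar r k s w;
  true_kkt : forall k s w, (s < S)%N ->
    kkt p (Hmat r k s w) (xit r k s w) (gtrue k s w)
      (dtrue r k s w) (ytrue r k s w)
}.

Record matrices (S : nat) (kappa_H zeta : R) : Prop := {
  H_sym : forall k s w, (s < S)%N -> (Hmat r k s w)^T = Hmat r k s w;
  H_bounded : forall k s w, (s < S)%N -> opnorm_le (Hmat r k s w) kappa_H;
  H_curvature : forall k s w (u : 'rV[R]_n), (s < S)%N ->
    u *m (jac p (xit r k s w))^T = 0 ->
    zeta * norm2 u ^+ 2 <= dotv (u *m Hmat r k s w) u
}.

Definition merit_event (sigma : R) (S ktau : nat) (tau_min : R) : set T :=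
  [set w | forall k s, (ktau <= k)%N -> (s < S)%N ->
    taubar r k s w = tau_min /\
    (tau_min%:E <= tau_trial p sigma (Hmat r k s w) (xit r k s w)
                     (gtrue k s w) (dtrue r k s w))%E].

Record delta_l_bounds (E : set T) (b S : nat) (kappa_l : R) : Prop := {
  delta_l_true : forall k s w, E w -> (s < S)%N ->
    kappa_l * taubar r k s w * norm2 (dtrue r k s w) ^+ 2
    <= delta_l p (xit r k s w) (taubar r k s w) (gtrue k s w) (dtrue r k s w);
  delta_l_bar : forall k s w, E w -> (s < S)%N ->
    kappa_l * taubar r k s w * norm2 (dbar r k s w) ^+ 2
    <= delta_l p (xit r k s w) (taubar r k s w) (gbar b k s w) (dbar r k s w)
}.

End Algorithm.

Section Randomness.
Context {R : realType} {n m N : nat} (p : problem R n m N).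
Context {d : measure_display} {T : measurableType d} (r : run R T n m N).

Record measurable_run (S : nat) : Prop := {
  m_x : forall k s, (s <= S)%N -> measurable_mx (xit r k s);
  m_tau : forall k s, (s < S)%N -> measurable_fun setT (taubar r k s);
  m_H : forall k s, (s < S)%N -> measurable_mx (Hmat r k s);
  m_batch : forall k s (I : {set 'I_N}), (s < S)%N ->
    measurable (batch r k s @^-1` [set I]);
  m_dbar : forall k s, (s < S)%N -> measurable_mx (dbar r k s);
  m_dtrue : forall k s, (s < S)%N -> measurable_mx (dtrue r k s)
}.

(* The information carried by x_{k,0} and x_{k,s}. *)
Definition reached k s : set (set T) :=
  sigma_mx (fun w => row_mx (xit r k 0 w) (xit r k s w)).

Record gradient_estimates (Q : probability T R) (L : R) (b S : nat) : Prop := {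
  gtilde_unbiased : forall k s (i : 'I_n), (s < S)%N ->
    is_cexp Q (reached k s) (fun w => gtilde p r b k s w 0 i)
                            (fun w => gtrue p r k s w 0 i);
  gbar_unbiased : forall k s (i : 'I_n), (s < S)%N ->
    is_cexp Q (reached k s) (fun w => gbar p r b k s w 0 i)
                            (fun w => gtrue p r k s w 0 i);
  gbar_variance : forall k s, (s < S)%N -> exists2 V : T -> R,
    is_cexp Q (reached k s)
      (fun w => norm2 (gbar p r b k s w - gtrue p r k s w) ^+ 2) V &
    {ae Q, forall w,
      V w <= L ^+ 2 / b%:R * norm2 (xit r k s w - xit r k 0 w) ^+ 2}
}.

(* Independence of the matrices and the gradient estimates, relative to the
   conditional expectations that are taken in the analysis. *)
Definition H_independent (Q : probability T R) (b S : nat) : Prop :=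
  forall k s, (s < S)%N ->
    cond_indep Q (reached k s)
      (sigma_mx (Hmat r k s)) (sigma_mx (gbar p r b k s)).

End Randomness.

(* Main.v *)
(** Write [noise] for the error of the gradient estimate and [Q] for the
    probability conditioned on the event of the merit parameter assumption.
    The two KKT systems share their matrix, so the computed direction differs
    from the true one by [- noise *m A], where A is a function of H and of the
    Jacobian that is bounded by 1/zeta. Conditional independence makes the noise
    orthogonal to every square-integrable vector that is measurable with respect
    to H, x_{k,0} and x_{k,s}; hence all terms linear in the noise vanish in
    expectation, and only the variance L^2/b |x_{k,s} - x_{k,0}|^2 survives.
    Combining this with the descent lemma for the merit function shows that
    E[phi(x_{k,s})] + lambda_s E[|x_{k,s} - x_{k,0}|^2] decreases by at least
    Lambda_s E[Delta l] in each inner step, and these decreases telescope, since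
    lambda_S = 0 and the distance vanishes for s = 0. With D = L^2/(rho^2 kappa_l
    zeta), the backward recursion for lambda has growth rate theta with
    S theta <= 2, so lambda_s = O(mu0 rho D N^(-gamma/2)), and Lambda_s >= alpha/2
    once mu0 is small. *)
Require Import Defs.
From HB Require Import structures.
From mathcomp Require Import all_boot all_order all_algebra.
From mathcomp Require Import all_classical all_reals all_analysis.
From mathcomp Require Import measurable_realfun.
From mathcomp Require Import ring lra.

Set Implicit Arguments.
Unset Strict Implicit.
Unset Printing Implicit Defensive.

Import Order.TTheory GRing.Theory Num.Theory.
Import numFieldNormedType.Exports.

Local Open Scope classical_set_scope.
Local Open Scope ring_scope.

(** * Step size constants *)

(** The obstacle is that the true direction depends on H as well as on the iterates, so unbiasedness
    given x_{k,0} and x_{k,s} does not by itself annihilate the cross terms: the noise must be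
    centered for the joint sigma-algebra of the iterates and H. Conditional independence is a
    statement about events, with separate versions of the conditional probabilities for each pair,
    and has to be lifted to the integrable noise. Square integrability of x_{k,s} - x_{k,0} is
    propagated along the inner loop, because X may be unbounded. The bounds on Delta l hold on the
    merit event only, so pathwise inequalities are compared up to a Q-null set. The dimensions m and
    n are arbitrary: for m > n the KKT matrix is singular, but the constraint alone fixes the
    direction, and A = 0 there. The constant is mu0 = 1 / (1 + D + 2 M) with M = (1/2 + e^2 D) /
    (tau_min kappa_l); e^2 bounds the growth of lambda over S steps, and nu0 = mu0 / 2 reflects
    Lambda_s >= alpha / 2. *)

Section StepSizeConstants.
Context {R : realType}.

Lemma expr1D_le_expR (theta : R) (j : nat) :
  0 <= theta -> (1 + theta) ^+ j <= expR (j%:R * theta).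
Proof.
move=> t0; rewrite expRM_natl; apply: lerXn2r; rewrite ?nnegrE ?expR_ge0//.
  by rewrite addr_ge0.
exact: expR_ge1Dx.
Qed.

(** Counting j steps back from S, the induction carries the bound C j (1 + theta)^j. It is cruder
    than the geometric sum but involves no division by theta. *)
Lemma backward_recursion_bound (lambda : nat -> R) (S : nat) (theta C : R) :
  0 <= theta -> 0 <= C -> lambda S = 0 ->
  (forall s, (s < S)%N -> lambda s = lambda s.+1 * (theta + 1) + C) ->
  forall s, (s <= S)%N ->
    0 <= lambda s <= C * S%:R * expR (S%:R * theta).
Proof.
move=> t0 C0 lS rec.
have t1 : 0 <= 1 + theta by rewrite addr_ge0.
have t1' : 1 <= 1 + theta by rewrite lerDl.
have main j : (j <= S)%N ->
    0 <= lambda (S - j)%N <= C * j%:R * (1 + theta) ^+ j.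
  elim: j => [_|j IH jS]; first by rewrite subn0 lS mulr0 mul0r lexx.
  have /andP[l0 l1] := IH (ltnW jS).
  rewrite rec; last by rewrite ltn_subrL (leq_trans _ jS).
  rewrite -subSn// subSS addr_ge0 ?mulr_ge0 ?(addrC theta)//=.
  apply: (@le_trans _ _ (C * j%:R * (1 + theta) ^+ j.+1 + C * (1 + theta) ^+ j.+1)).
    apply: lerD; first by rewrite exprSr mulrA ler_wpM2r.
    by rewrite ler_peMr// exprn_ege1// lerDl.
  by rewrite -natr1 mulrDr mulr1 [leRHS]mulrDl.
move=> s sS.
have := main (S - s)%N (leq_subr _ _); rewrite subKn// => /andP[-> h] /=.
apply: (le_trans h).
have Sj : ((S - s)%:R <= S%:R :> R) by rewrite ler_nat leq_subr.
apply: ler_pM; rewrite ?mulr_ge0 ?exprn_ge0//; first by rewrite ler_wpM2l.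
apply: (le_trans (expr1D_le_expR _ t0)).
by rewrite ler_expR ler_wpM2r.
Qed.

(* Here [p] is N^(gamma/2) and [D] is L^2/(rho^2 kappa_l zeta). *)
Lemma Lambda_ge_half (rho zeta kl tau L mu0 p b S alpha z lam : R)
    (D := L ^+ 2 / (rho ^+ 2 * kl * zeta))
    (theta := alpha ^+ 2 * L ^+ 2 / (kl * b * zeta) + alpha * z)
    (C := alpha ^+ 2 * rho * L ^+ 2 / (2 * kl * b * zeta)) :
  0 < rho -> 0 < zeta -> 0 < kl -> 0 < tau ->
  0 < mu0 <= 1 -> mu0 * D <= 1 ->
  mu0 * (2^-1 + expR 2 * D) / (tau * kl) <= 2^-1 ->
  1 <= p -> 1 <= b -> b < p ^+ 2 -> 0 <= S ->
  S <= p ^+ 3 / (mu0 * (b + D)) ->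
  alpha = mu0 * b / (rho * p ^+ 2) -> z = rho / p ->
  0 <= lam <= C * S * expR (S * theta) ->
  mu0 / 2 * b / (rho * p ^+ 2) <=
    alpha - alpha ^+ 2 * rho / (2 * tau * kl)
    - lam * (alpha / (tau * kl)) * (alpha + z^-1).
Proof.
move=> rho0 zeta0 kl0 tau0 /andP[mu00 mu01] muD muE p1 b1 bp S0 SS aE zE.
move=> /andP[lam0 lamC].
have D0 : 0 <= D by rewrite /D divr_ge0 ?sqr_ge0// !mulr_ge0 ?sqr_ge0 ?ltW.
have p0 : 0 < p by rewrite (lt_le_trans _ p1).
have b0 : 0 < b by rewrite (lt_le_trans _ b1).
have [mu0' p0' rho0' b0'] : [/\ 0 <= mu0, 0 <= p, 0 <= rho & 0 <= b].
  by split; exact: ltW.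
have bD0 : 0 < b + D by rewrite ltr_wpDr.
have a0 : 0 < alpha by rewrite aE divr_gt0 ?mulr_gt0 ?exprn_gt0.
have SS' : S * (mu0 * (b + D)) <= p ^+ 3 by rewrite -ler_pdivlMr// mulr_gt0.
(* Both summands of [theta] contain the factor mu0 b / p^3, and so does [C]; the bound on S implies
   that S times this factor is at most 1. *)
have thetaE : theta = mu0 * b / p ^+ 3 * (1 + mu0 * D / p).
  by rewrite /theta /D aE zE; field; rewrite !gt_eqF.
have CE : C = mu0 * rho * D / (2 * p) * (mu0 * b / p ^+ 3).
  by rewrite /C /D aE; field; rewrite !gt_eqF.
have Sb : S * (mu0 * b / p ^+ 3) <= 1.
  rewrite mulrA ler_pdivrMr ?exprn_gt0// mul1r (le_trans _ SS')//.
  by rewrite ler_wpM2l// ler_pM2l// lerDl.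
have Sb0 : 0 <= S * (mu0 * b / p ^+ 3).
  by rewrite mulr_ge0// divr_ge0 ?exprn_ge0 ?mulr_ge0// ?ltW//.
have muDp : mu0 * D / p <= 1.
  by rewrite ler_pdivrMr// mul1r (le_trans muD).
have St : S * theta <= 2.
  have t0 : 0 <= mu0 * D / p by apply: divr_ge0; [apply: mulr_ge0 => //|]; exact: ltW.
  rewrite thetaE mulrA.
  have : S * (mu0 * b / p ^+ 3) * (1 + mu0 * D / p) <= 1 * 2.
    by apply: ler_pM => //; lra.
  by rewrite mul1r.
have mrD : 0 <= mu0 * rho * D / (2 * p).
  by apply: divr_ge0; apply: mulr_ge0 => //; apply: mulr_ge0.
have lam1 : lam <= mu0 * rho * D / (2 * p) * expR 2.
  apply: (le_trans lamC); apply: ler_pM.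
  - by rewrite CE -mulrA (mulrC _ S) mulr_ge0.
  - exact: expR_ge0.
  - by rewrite CE -mulrA (mulrC _ S) ler_piMr.
  - by rewrite ler_expR.
have az : alpha + z^-1 <= 2 * (p / rho).
  have bp' : b / p ^+ 2 <= 1 by rewrite ler_pdivrMr ?exprn_gt0// mul1r ltW.
  rewrite zE invf_div mulr_natl mulr2n lerD2r aE invfM mulrA mulrAC ler_pM2r
    ?invr_gt0//.
  rewrite -mulrA (le_trans _ p1)// mulr_ile1// ?divr_ge0 ?exprn_ge0//; exact: ltW.
have az0 : 0 <= alpha + z^-1.
  by rewrite addr_ge0 ?(ltW a0)// zE invf_div divr_ge0 ?ltW.
(* This is where z = rho / p pays off: the bound on [lam] carries 1 / p, the bound on alpha + 1 / z
   carries p, and p cancels. *)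
have lamaz : lam * (alpha + z^-1) <= mu0 * D * expR 2.
  apply: (le_trans (ler_pM lam0 az0 lam1 az)).
  rewrite le_eqVlt; apply/orP; left; apply/eqP; field; rewrite !gt_eqF//.
have arho : alpha * rho <= mu0.
  rewrite aE; have -> : mu0 * b / (rho * p ^+ 2) * rho = mu0 * (b / p ^+ 2).
    by field; rewrite !gt_eqF.
  by rewrite ler_piMr ?ltW// ltr_pdivrMr ?exprn_gt0// mul1r.
have tk0 : 0 < (tau * kl)^-1 by rewrite invr_gt0 mulr_gt0.
have -> : mu0 / 2 * b / (rho * p ^+ 2) = alpha * 2^-1.
  by rewrite aE; field; rewrite !gt_eqF.
(* With alpha factored out, it remains to bound the subtracted term by 1/2, which is the hypothesis
   on mu0 (1/2 + e^2 D). *)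
have -> : alpha - alpha ^+ 2 * rho / (2 * tau * kl)
    - lam * (alpha / (tau * kl)) * (alpha + z^-1)
  = alpha * (1 - (alpha * rho / 2 + lam * (alpha + z^-1)) * (tau * kl)^-1).
  by field; rewrite !gt_eqF// zE divr_gt0.
rewrite ler_pM2l//.
suff : (alpha * rho / 2 + lam * (alpha + z^-1)) * (tau * kl)^-1 <= 2^-1 by lra.
apply: le_trans muE; rewrite ler_pM2r//; lra.
Qed.

End StepSizeConstants.

(** * Euclidean norm and descent *)

Section DotProduct.
Context {R : realType}.
Implicit Type n : nat.

Lemma dotvE n (u v : 'rV[R]_n) : dotv u v = (u *m v^T) 0 0.
Proof. by rewrite mxE; apply: eq_bigr => i _; rewrite mxE. Qed.

Lemma dotvC n (u v : 'rV[R]_n) : dotv u v = dotv v u.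
Proof. by apply: eq_bigr => i _; rewrite mulrC. Qed.

Lemma dotvDl n (u v w : 'rV[R]_n) : dotv (u + v) w = dotv u w + dotv v w.
Proof. by rewrite !dotvE mulmxDl mxE. Qed.

Lemma dotvZl n (a : R) (u v : 'rV[R]_n) : dotv (a *: u) v = a * dotv u v.
Proof. by rewrite !dotvE -scalemxAl mxE. Qed.

Lemma dotvNl n (u v : 'rV[R]_n) : dotv (- u) v = - dotv u v.
Proof. by rewrite -scaleN1r dotvZl mulN1r. Qed.

Lemma dotvBl n (u v w : 'rV[R]_n) : dotv (u - v) w = dotv u w - dotv v w.
Proof. by rewrite dotvDl dotvNl. Qed.

Lemma dotvDr n (u v w : 'rV[R]_n) : dotv w (u + v) = dotv w u + dotv w v.
Proof. by rewrite dotvC dotvDl !(dotvC w). Qed.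

Lemma dotvZr n (a : R) (u v : 'rV[R]_n) : dotv u (a *: v) = a * dotv u v.
Proof. by rewrite dotvC dotvZl dotvC. Qed.

Lemma dotvNr n (u v : 'rV[R]_n) : dotv u (- v) = - dotv u v.
Proof. by rewrite dotvC dotvNl dotvC. Qed.

Lemma dotvBr n (u v w : 'rV[R]_n) : dotv w (u - v) = dotv w u - dotv w v.
Proof. by rewrite dotvDr dotvNr. Qed.

Lemma dotv0l n (v : 'rV[R]_n) : dotv 0 v = 0.
Proof. by rewrite -(scale0r 0) dotvZl mul0r. Qed.

Lemma dotv_mulmx m n (u : 'rV[R]_m) (A : 'M[R]_(m, n)) (v : 'rV[R]_n) :
  dotv (u *m A) v = dotv u (v *m A^T).
Proof. by rewrite !dotvE trmx_mul trmxK mulmxA. Qed.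

Lemma dotv_ge0 n (u : 'rV[R]_n) : 0 <= dotv u u.
Proof. by apply: sumr_ge0 => i _; rewrite -expr2 sqr_ge0. Qed.

Lemma norm2_ge0 n (u : 'rV[R]_n) : 0 <= norm2 u.
Proof. exact: sqrtr_ge0. Qed.

Lemma norm2_sqr n (u : 'rV[R]_n) : norm2 u ^+ 2 = dotv u u.
Proof. by rewrite sqr_sqrtr// dotv_ge0. Qed.

Lemma dotv_eq0 n (u : 'rV[R]_n) : dotv u u = 0 -> u = 0.
Proof.
move=> /eqP; rewrite psumr_eq0 => [|i _]; last by rewrite -expr2 sqr_ge0.
move=> /allP u0; apply/rowP => i; rewrite mxE.
by have := u0 i (mem_index_enum _); rewrite mulf_eq0 orbb => /eqP.
Qed.

Lemma norm2_eq0 n (u : 'rV[R]_n) : norm2 u = 0 -> u = 0.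
Proof. by move=> u0; apply: dotv_eq0; rewrite -norm2_sqr u0 expr0n. Qed.

(** Cauchy-Schwarz, by expanding the square of |v| u - |u| v and dividing by |u| |v|. *)
Lemma dotv_le_norm2 n (u v : 'rV[R]_n) : dotv u v <= norm2 u * norm2 v.
Proof.
have [u0|u0] := eqVneq (norm2 u) 0.
  by rewrite u0 mul0r (norm2_eq0 u0) dotv0l.
have [v0|v0] := eqVneq (norm2 v) 0.
  by rewrite v0 mulr0 (norm2_eq0 v0) dotvC dotv0l.
have uv0 : 0 < norm2 u * norm2 v by rewrite mulr_gt0// lt0r ?u0 ?v0 norm2_ge0.
have := dotv_ge0 (norm2 v *: u - norm2 u *: v).
rewrite dotvBl !dotvBr !dotvZl !dotvZr -!norm2_sqr (dotvC v u) => h.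
rewrite -(ler_pM2l uv0); nra.
Qed.

Lemma normr_dotv_le n (u v : 'rV[R]_n) : `|dotv u v| <= norm2 u * norm2 v.
Proof.
rewrite ler_norml dotv_le_norm2 andbT lerNl -dotvNl (le_trans (dotv_le_norm2 _ _))//.
by rewrite /norm2 dotvNl dotvC dotvNl opprK.
Qed.

Lemma norm2Z n (a : R) (u : 'rV[R]_n) : norm2 (a *: u) = `|a| * norm2 u.
Proof.
by rewrite /norm2 dotvZl dotvZr mulrA -expr2 sqrtrM ?sqr_ge0// sqrtr_sqr.
Qed.

Lemma norm2D n (u v : 'rV[R]_n) : norm2 (u + v) <= norm2 u + norm2 v.
Proof.
rewrite -(@ler_pXn2r _ 2)// ?nnegrE ?addr_ge0 ?norm2_ge0//.
rewrite norm2_sqr dotvDl !dotvDr -!norm2_sqr (dotvC v u).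
have := dotv_le_norm2 u v; nra.
Qed.

Lemma norm2_sum n N (F : 'I_N -> 'rV[R]_n) :
  norm2 (\sum_i F i) <= \sum_i norm2 (F i).
Proof.
elim/big_ind2 : _ => //.
  by rewrite /norm2 dotv0l sqrtr0.
by move=> a b c e ab ce; rewrite (le_trans (norm2D _ _))// lerD.
Qed.

End DotProduct.

Section Descent.
Context {R : realType} {n : nat}.
Implicit Types (f : 'rV[R]_n -> R) (x y v : 'rV[R]_n).

Lemma derive_grad f x v : differentiable f x -> 'D_v f x = dotv (grad f x) v.
Proof.
move=> df; rewrite deriveE// {1}(row_sum_delta v) linear_sum.
by apply: eq_bigr => i _; rewrite linearZ mxE deriveE// mulrC.
Qed.

Lemma is_derive_line f x v (t : R) : differentiable f (x + t *: v) ->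
  is_derive t 1 (fun t : R => f (x + t *: v)) (dotv (grad f (x + t *: v)) v).
Proof.
move=> df; have dv : derivable f (x + t *: v) v by exact: diff_derivable.
have E : (fun h : R => h^-1 *: (((fun t : R => f (x + t *: v)) \o shift t) (h *: 1)
            - f (x + t *: v)))
       = (fun h : R => h^-1 *: ((f \o shift (x + t *: v)) (h *: v) - f (x + t *: v))).
  apply/funext => h /=; congr (_ *: (f _ - _)).
  by rewrite [h%:A]mulr1 scalerDl addrCA.
by split; rewrite -?derive_grad// /derivable /derive E.
Qed.

(** The function [psi] below has derivative dh t - dh 0 - K t <= 0, so the mean value theorem gives
    psi 1 <= psi 0. This takes the place of integrating [dh]. *)
Lemma quadratic_upper_bound (h dh : R -> R) (K : R) :
  (forall t : R, t \in `[0, 1] -> is_derive t 1 h (dh t)) ->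
  (forall t : R, t \in `[0, 1] -> dh t - dh 0 <= K * t) ->
  h 1 <= h 0 + dh 0 + K / 2.
Proof.
move=> hd hK.
pose psi (t : R) := h t - dh 0 * t - K / 2 * t ^+ 2.
have psid (t : R) : t \in `[0, 1] -> is_derive t 1 psi (dh t - dh 0 - K * t).
  move=> /hd ht; rewrite /psi; apply: is_derive_eq.
  by rewrite /= /GRing.scale /=; field.
have psic : {within `[0, 1], continuous psi}.
  apply: derivable_within_continuous => t /psid [] //.
have [c c01] := MVT ltr01 (fun t t01 => psid t (subset_itv_oo_cc t01)) psic.
have := hK c (subset_itv_oo_cc c01); rewrite /psi; lra.
Qed.

Lemma convex_set_line (X : set 'rV[R]_n) x v t : convex_set X ->
  X x -> X (x + v) -> t \in `[0, 1] -> X (x + t *: v).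
Proof.
move=> cX Xx Xv; rewrite in_itv /= => /andP[t0 t1].
have := cX (x + v) x (Itv01 t0 t1) (mem_set Xv) (mem_set Xx).
rewrite inE; congr (X _); rewrite /conv /= /conv /=.
by rewrite /unstable.onem scalerDr scalerBl scale1r addrAC [t *: x + _]addrC subrK.
Qed.

Lemma descent_le (X : set 'rV[R]_n) L f x v : convex_set X ->
  (forall y, X y -> differentiable f y) -> lipschitz2_on X L (grad f) ->
  X x -> X (x + v) ->
  f (x + v) <= f x + dotv (grad f x) v + L / 2 * norm2 v ^+ 2.
Proof.
move=> cX df Lf Xx Xv.
have Xt (t : R) : t \in `[0, 1] -> X (x + t *: v) by exact: convex_set_line.
have := @quadratic_upper_bound (fun t => f (x + t *: v))
  (fun t => dotv (grad f (x + t *: v)) v) (L * norm2 v ^+ 2).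
rewrite scale1r scale0r addr0 mulrAC; apply.
  by move=> t /Xt/df; exact: is_derive_line.
move=> t t01; rewrite -dotvBl (le_trans (dotv_le_norm2 _ _))//.
have := Lf _ _ (Xt _ t01) Xx; rewrite [x + _]addrC addrK norm2Z.
move: t01; rewrite in_itv /= => /andP[t0 _]; rewrite (ger0_norm t0) => h.
by rewrite (le_trans (ler_wpM2r (norm2_ge0 _) h))// expr2; nra.
Qed.

Lemma gradN f x : differentiable f x -> grad (- f) x = - grad f x.
Proof.
move=> df; apply/rowP => i; rewrite !mxE deriveN//; exact: diff_derivable.
Qed.

Lemma norm2N (v : 'rV[R]_n) : norm2 (- v) = norm2 v.
Proof. by rewrite -scaleN1r norm2Z normrN1 mul1r. Qed.

(** The descent inequality is applied to f and to - f. The linearization stays inside the absolute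
    value because for a constraint along a KKT direction it equals (1 - alpha) c_i. *)
Lemma descent_norm (X : set 'rV[R]_n) L f x v : convex_set X ->
  (forall y, X y -> differentiable f y) -> lipschitz2_on X L (grad f) ->
  X x -> X (x + v) ->
  `|f (x + v)| <= `|f x + dotv (grad f x) v| + L / 2 * norm2 v ^+ 2.
Proof.
move=> cX df Lf Xx Xv.
have h1 := descent_le cX df Lf Xx Xv.
have : (- f) (x + v) <= (- f) x + dotv (grad (- f) x) v + L / 2 * norm2 v ^+ 2.
  apply: (descent_le cX) => // [y Xy|y z Xy Xz].
    by apply: differentiableN; exact: df.
  rewrite !gradN; [|exact: df..].
  by rewrite -opprD norm2N; exact: Lf.
rewrite gradN; last exact: df.
rewrite dotvNl !fctE => h2.
have := ler_norm (f x + dotv (grad f x) v).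
have := ler_norm (- (f x + dotv (grad f x) v)); rewrite normrN.
by move=> h3 h4; rewrite ler_norml; apply/andP; split; lra.
Qed.

End Descent.

Section MeritDescent.
Context {R : realType} {n m N : nat} (p : problem R n m N).
Context (X : set 'rV[R]_n) (L : R) (gam : 'I_m -> R).
Hypothesis smooth : smoothness p X L gam.

Lemma objectiveE : objective p = N%:R^-1 \*o (\sum_(i < N) Defs.comp p i).
Proof. by apply/funext => x; rewrite /objective fct_sumE. Qed.

Lemma differentiable_comp i x : X x -> differentiable (Defs.comp p i) x.
Proof. by move=> /(f_C1 smooth i)[]. Qed.

Lemma differentiable_objective x : X x -> differentiable (objective p) x.
Proof.
move=> Xx; rewrite objectiveE; apply: differentiableZ.
by apply: differentiable_sum => i; exact: differentiable_comp.
Qed.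

Lemma grad_objective x : X x ->
  grad (objective p) x = N%:R^-1 *: \sum_(i < N) grad (Defs.comp p i) x.
Proof.
move=> Xx; apply/rowP => j; rewrite !mxE objectiveE.
have dc i : derivable (Defs.comp p i) x (delta_mx 0 j : 'rV[R]_n).
  by apply: diff_derivable; exact: differentiable_comp.
rewrite deriveZ; last exact: derivable_sum.
rewrite derive_sum// /GRing.scale /= summxE; congr (_ * _).
by apply: eq_bigr => i _; rewrite mxE.
Qed.

Lemma lipschitz_objective : (0 < N)%N ->
  lipschitz2_on X L (grad (objective p)).
Proof.
move=> N0 x y Xx Xy; rewrite !grad_objective// -scalerBr -sumrB norm2Z.
rewrite ger0_norm ?invr_ge0// mulrC ler_pdivrMr ?ltr0n//.
rewrite (le_trans (norm2_sum _))//.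
rewrite (@le_trans _ _ (\sum_(i < N) L * norm2 (x - y)))//.
  by apply: ler_sum => i _; exact: (f_lipschitz smooth i).
by rewrite sumr_const card_ord mulr_natr.
Qed.

Lemma dotv_grad_constr i x v :
  dotv (grad (constr_i p i) x) v = (v *m (jac p x)^T) 0 i.
Proof. by rewrite mxE; apply: eq_bigr => j _; rewrite !mxE mulrC. Qed.

(** Since J v = - c, the linearized constraint is (1 - alpha) c, whose l1 norm loses alpha |c|_1;
    together with the linear term alpha tau g v of the objective this makes - alpha Delta l. The
    Lipschitz constants enter the quadratic term only. *)
Lemma merit_descent x v tau alpha : (0 < N)%N -> X x -> X (x + alpha *: v) ->
  0 <= alpha <= 1 -> 0 <= tau -> v *m (jac p x)^T = - constr p x ->
  merit p (x + alpha *: v) tau <= merit p x tau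
    - alpha * delta_l p x tau (grad (objective p) x) v
    + (tau * L + \sum_(i < m) gam i) / 2 * alpha ^+ 2 * norm2 v ^+ 2.
Proof.
move=> N0 Xx Xv /andP[a0 a1] t0 vJ.
have := descent_le (X_convex smooth) differentiable_objective
  (lipschitz_objective N0) Xx Xv.
rewrite dotvZr norm2Z exprMn real_normK ?num_real// => hf.
have hc : norm1 (constr p (x + alpha *: v)) <= (1 - alpha) * norm1 (constr p x)
    + (\sum_(i < m) gam i) / 2 * alpha ^+ 2 * norm2 v ^+ 2.
  rewrite /norm1 mulr_sumr -!mulrA mulr_suml -big_split /=.
  apply: ler_sum => i _.
  have := descent_norm (X_convex smooth) (fun y Xy => (c_C1 smooth i Xy).1)
    (@c_lipschitz _ _ _ _ _ _ _ _ smooth i) Xx Xv.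
  rewrite dotvZr dotv_grad_constr vJ mxE norm2Z exprMn real_normK ?num_real//.
  have -> : constr_i p i x + alpha * - constr p x 0 i
          = (1 - alpha) * constr p x 0 i by rewrite /constr_i; ring.
  by rewrite normrM ger0_norm ?subr_ge0// -!mulrA.
rewrite /merit /delta_l.
have := ler_wpM2l t0 hf; nra.
Qed.

End MeritDescent.

(** * The KKT system *)

Section KKT.
Context {R : realType} {n m : nat}.
Implicit Types (H : 'M[R]_n) (J : 'M[R]_(m, n)).

Definition kkt_inv H J := invmx (block_mx H J^T J 0).

(* The direction in the KKT system is [- (g *m kktA + c *m kktB)]. If [m > n],
   then J has full column rank and the constraint determines the direction. *)
Definition kktA H J : 'M[R]_n :=
  if (m <= n)%N then ulsubmx (kkt_inv H J) else 0.

Definition kktB H J : 'M[R]_(m, n) :=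
  if (m <= n)%N then dlsubmx (kkt_inv H J) else J *m invmx (J^T *m J).

Context (H : 'M[R]_n) (J : 'M[R]_(m, n)) (zeta : R).
Hypothesis zeta_gt0 : 0 < zeta.
Hypothesis J_sv : forall sv, singular_value J sv -> 0 < sv.
Hypothesis H_curv : forall u : 'rV[R]_n, u *m J^T = 0 ->
  zeta * norm2 u ^+ 2 <= dotv (u *m H) u.

Lemma ex_left_kernel k l (A : 'M[R]_(k, l)) : (\rank A < k)%N ->
  exists2 u : 'rV[R]_k, u != 0 & u *m A = 0.
Proof.
move=> rA; have : kermx A != 0 by rewrite kermx_eq0 /row_free neq_ltn rA.
by case/rowV0Pn => u /sub_kermxP uA u0; exists u.
Qed.

Lemma left_kernel_unitmx k (A : 'M[R]_k) :
  (forall u : 'rV[R]_k, u *m A = 0 -> u = 0) -> A \in unitmx.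
Proof.
move=> h; rewrite -row_free_unit -kermx_eq0.
by apply/rowV0P => u /sub_kermxP; exact: h.
Qed.

(** The form in which positivity of the singular values is used: kernel vectors on both sides would
    make 0 a singular value. So J has full row rank for m <= n and full column rank for n < m. *)
Lemma no_double_kernel (u : 'rV[R]_m) (v : 'rV[R]_n) :
  u != 0 -> v != 0 -> u *m J = 0 -> v *m J^T = 0 -> False.
Proof.
move=> u0 v0 uJ vJ; suff /J_sv : singular_value J 0 by rewrite ltxx.
by split => //; exists u, v; rewrite !scale0r.
Qed.

(** For (u, y) in the left kernel, J u = 0, and pairing u H + y J = 0 with u gives u H u = 0, so the
    curvature condition forces u = 0. Then y J = 0, and full row rank gives y = 0. *)
Lemma kkt_unitmx : (m <= n)%N -> block_mx H J^T J 0 \in unitmx.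
Proof.
move=> mn; apply: left_kernel_unitmx => w; rewrite -[w]hsubmxK.
set u := lsubmx w; set y := rsubmx w.
rewrite mul_row_block mulmx0 addr0 => /eqP.
rewrite -[0](@row_mx0 _ 1 n m) => /eqP/eq_row_mx[uH uJ].
have u0 : u = 0.
  apply: norm2_eq0; apply/eqP; rewrite -sqrf_eq0 eq_le sqr_ge0 andbT.
  rewrite -(pmulr_rle0 _ zeta_gt0) (le_trans (H_curv uJ))//.
  have -> : u *m H = - (y *m J) by apply/eqP; rewrite -addr_eq0 uH.
  by rewrite dotvNl dotv_mulmx uJ dotvC dotv0l oppr0.
have yJ : y *m J = 0 by move: uH; rewrite u0 mul0mx add0r.
suff -> : y = 0 by rewrite u0.
apply/eqP/negPn/negP => y0.
have rJ : (\rank J < m)%N.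
  rewrite ltn_neqAle rank_leq_row andbT; apply/negP => fJ.
  by move/eqP: yJ; rewrite mulmx_free_eq0 ?(negPf y0).
have [v v0 vJ] : exists2 v : 'rV[R]_n, v != 0 & v *m J^T = 0.
  by apply: ex_left_kernel; rewrite mxrank_tr (leq_trans rJ).
exact: (no_double_kernel y0 v0).
Qed.

Lemma gram_unitmx : (n < m)%N -> J^T *m J \in unitmx.
Proof.
move=> nm; apply: left_kernel_unitmx => v vJJ.
have vJ : v *m J^T = 0.
  apply: dotv_eq0; rewrite dotv_mulmx trmxK -mulmxA vJJ dotvC; exact: dotv0l.
apply/eqP/negPn/negP => v0.
have [u u0 uJ] : exists2 u : 'rV[R]_m, u != 0 & u *m J = 0.
  by apply: ex_left_kernel; rewrite (leq_ltn_trans (rank_leq_col _)).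
exact: (no_double_kernel u0 v0).
Qed.

(** For n < m the rows of [J 0] are dependent, so the KKT matrix cannot be inverted; instead dir J^T
    = - c is solved by means of the Gram matrix J^T J. *)
Lemma kkt_dirE (g dir : 'rV[R]_n) (c y : 'rV[R]_m) :
  row_mx dir y *m block_mx H J^T J 0 = - row_mx g c ->
  dir = - (g *m kktA H J + c *m kktB H J).
Proof.
rewrite /kktA /kktB; case: leqP => [mn|nm] E.
  have : row_mx dir y = - row_mx g c *m kkt_inv H J.
    by rewrite -E mulmxK// kkt_unitmx.
  rewrite -{1}[kkt_inv H J]submxK mulNmx mul_row_block opp_row_mx.
  by case/eq_row_mx.
rewrite mulmx0 add0r mulmxA.
move: E; rewrite mul_row_block opp_row_mx mulmx0 addr0 => /eq_row_mx[_ dJ].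
by rewrite -!mulNmx -dJ -(mulmxA dir) mulmxK// gram_unitmx.
Qed.

(** For m <= n, e = w A is the direction part of the KKT solution with right-hand side (w, 0). Thus
    J e = 0, and pairing the first block with e leaves zeta |e|^2 <= e H e = w e <= |w| |e|. *)
Lemma norm2_kktA (w : 'rV[R]_n) : norm2 (w *m kktA H J) <= norm2 w / zeta.
Proof.
rewrite /kktA; case: leqP => [mn|nm]; last first.
  by rewrite mulmx0 /norm2 dotv0l sqrtr0 divr_ge0 ?sqrtr_ge0// ltW.
set e := w *m _.
have : row_mx w 0 *m kkt_inv H J *m block_mx H J^T J 0 = row_mx w 0.
  by rewrite /kkt_inv mulmxKV// kkt_unitmx.
rewrite -{1}[kkt_inv H J]submxK mul_row_block !mul0mx !addr0 -/e.
rewrite mul_row_block mulmx0 addr0 => /eq_row_mx[eH eJ].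
have := H_curv eJ.
rewrite -[e *m H](addrK (w *m ursubmx (kkt_inv H J) *m J)) eH.
rewrite dotvBl [dotv (_ *m J) _]dotv_mulmx eJ [X in _ - X]dotvC dotv0l subr0 => h.
have := le_trans h (dotv_le_norm2 _ _); rewrite expr2 mulrA.
have [->|e0] := eqVneq (norm2 e) 0.
  by rewrite divr_ge0 ?norm2_ge0// ltW.
rewrite ler_pM2r ?lt0r ?e0 ?norm2_ge0// => h'.
by rewrite ler_pdivlMr// mulrC.
Qed.

End KKT.

(** * Conditional expectation and independence *)

Section Expectation.
Context {d : measure_display} {T : measurableType d} {R : realType}.
Variable Q : probability T R.
Implicit Types (X Y Z U W : T -> R) (A B : set T).

Definition intg X : Prop := Q.-integrable setT (EFin \o X).

Definition Ex X : R := Rintegral Q setT X.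

Lemma intg_measurable X : intg X -> measurable_fun setT X.
Proof. by case/integrableP => /measurable_EFinP. Qed.

Lemma ExE X : intg X -> (\int[Q]_w (X w)%:E)%E = (Ex X)%:E.
Proof. by move=> iX; rewrite fineK// integrable_fin_num. Qed.

Lemma intg_eq X Y : X =1 Y -> intg X -> intg Y.
Proof. by move=> /funext ->. Qed.

Lemma eq_Ex X Y : X =1 Y -> Ex X = Ex Y.
Proof. by move=> /funext ->. Qed.

Lemma intgD X Y : intg X -> intg Y -> intg (fun w => X w + Y w).
Proof. by move=> iX iY; exact: (integrableD measurableT iX iY). Qed.

Lemma intgZ (a : R) X : intg X -> intg (fun w => a * X w).
Proof. exact: integrableZl. Qed.

Lemma intgB X Y : intg X -> intg Y -> intg (fun w => X w - Y w).
Proof. by move=> iX iY; exact: (integrableB measurableT iX iY). Qed.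

Lemma intg_cst (a : R) : intg (cst a).
Proof. exact: finite_measure_integrable_cst. Qed.

Lemma intg_dom X Y : measurable_fun setT X -> intg Y ->
  (forall w, `|X w| <= `|Y w|) -> intg X.
Proof.
move=> mX iY XY; apply: le_integrable iY => //; first exact/measurable_EFinP.
by move=> w _ /=; rewrite lee_fin.
Qed.

Lemma intg_sum I (r : seq I) (P : pred I) (F : I -> T -> R) :
  (forall i, P i -> intg (F i)) -> intg (fun w => \sum_(i <- r | P i) F i w).
Proof.
move=> iF; have := integrable_sum measurableT r iF.
by congr (Q.-integrable _ _); apply/funext => w; rewrite /= sumEFin.
Qed.

Lemma ExD X Y : intg X -> intg Y -> Ex (fun w => X w + Y w) = Ex X + Ex Y.
Proof. exact: RintegralD. Qed.

Lemma ExB X Y : intg X -> intg Y -> Ex (fun w => X w - Y w) = Ex X - Ex Y.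
Proof. exact: RintegralB. Qed.

Lemma ExZ (a : R) X : intg X -> Ex (fun w => a * X w) = a * Ex X.
Proof. exact: RintegralZl. Qed.

Lemma Ex_cst (a : R) : Ex (cst a) = a.
Proof.
rewrite /Ex /Rintegral; under eq_integral do rewrite /=.
by rewrite integral_cst// [X in (_ * X)%E]probability_setT mule1.
Qed.

Lemma Ex_sum I (r : seq I) (F : I -> T -> R) :
  (forall i, intg (F i)) -> Ex (fun w => \sum_(i <- r) F i w) = \sum_(i <- r) Ex (F i).
Proof.
move=> iF; elim: r => [|i r IH].
  by rewrite big_nil -[RHS](Ex_cst 0); apply: eq_Ex => w; rewrite big_nil.
rewrite big_cons -IH -ExD//; last exact: intg_sum.
by apply: eq_Ex => w; rewrite big_cons.
Qed.

Lemma le_Ex X Y : intg X -> intg Y -> (forall w, X w <= Y w) -> Ex X <= Ex Y.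
Proof. by move=> iX iY XY; apply: le_Rintegral. Qed.

Lemma intg_restr X A : measurable A -> intg X -> intg (fun w => X w * \1_A w).
Proof.
move=> mA iX; apply: (intg_dom _ iX).
  by apply: measurable_funM; [exact: intg_measurable|exact: measurable_indic].
move=> w; rewrite normrM ler_piMr// indicE.
by case: (w \in A); rewrite ?normr1 ?normr0.
Qed.

Lemma integral_restr X A : measurable A ->
  (\int[Q]_(w in A) (X w)%:E = \int[Q]_w (X w * \1_A w)%:E)%E.
Proof.
move=> mA; rewrite integral_mkcond; apply: eq_integral => w _.
by rewrite epatch_indic.
Qed.

Lemma Ex_dominated_cvg (f : nat -> T -> R) X Y :
  (forall k, measurable_fun setT (f k)) -> intg Y ->
  (forall k w, `|f k w| <= Y w) -> (forall w, f ^~ w @ \oo --> X w) ->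
  Ex (f k) @[k --> \oo] --> Ex X.
Proof.
move=> mf iY fY fX.
have mX : measurable_fun setT X by apply: (measurable_fun_cvg mf) => w _.
have intf k : intg (f k).
  apply: (intg_dom (mf k) iY) => w; rewrite (le_trans (fY k w))//; exact: ler_norm.
have : (\int[Q]_w (f k w)%:E)%E @[k --> \oo] --> (\int[Q]_w (X w)%:E)%E.
  apply: (@dominated_cvg _ _ _ _ _ measurableT _ _ (EFin \o Y)) => //.
  - by move=> k; apply/measurable_EFinP.
  - by move=> w _; apply: cvg_comp (fX w) _.
  - by move=> k w _ /=; rewrite lee_fin.
have iX : intg X.
  apply: (intg_dom mX iY) => w; apply: (@le_trans _ _ (Y w)); last exact: ler_norm.
  have fnX : `|f k w| @[k --> \oo] --> `|X w| by apply: cvg_norm; exact: fX.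
  apply: (cvgr_to_le fnX).
  by near=> k; exact: fY.
under eq_fun do rewrite ExE//.
by rewrite ExE// => /fine_cvgP[].
Unshelve. all: by end_near. Qed.

End Expectation.

Section Orthogonality.
Context {d : measure_display} {T : measurableType d} {R : realType}.
Variable Q : probability T R.
Implicit Types (X Y Z U W : T -> R) (A B : set T) (G : set (set T)).

Definition sub_measurable G X : Prop :=
  measurable_fun (setT : set (g_sigma_algebraType G)) X.

Lemma sub_measurableP G X : sub_measurable G X <->
  (forall B : set R, measurable B -> <<s G>> (X @^-1` B)).
Proof.
split => [mX B mB|mX _ B mB]; last by rewrite setTI; exact: mX.
by have := mX measurableT B mB; rewrite setTI.
Qed.

Lemma sub_measurableW G X : <<s G>> `<=` measurable -> sub_measurable G X ->
  measurable_fun setT X.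
Proof.
move=> sG /sub_measurableP mX _ B mB; rewrite setTI; apply: sG; exact: mX.
Qed.

(** For integrable W this is E[W | sigma(G)] = 0, phrased without choosing a version of the
    conditional expectation. *)
Definition centered G W : Prop :=
  intg Q W /\ forall A, <<s G>> A -> Ex Q (fun w => W w * \1_A w) = 0.

(* By dominated convergence along the dyadic approximations of U, whose level
   sets belong to the sub-sigma-algebra. *)
Lemma Ex_mul_centered_ge0 G U W : <<s G>> `<=` measurable ->
  sub_measurable G U -> (forall w, 0 <= U w) -> centered G W ->
  intg Q (fun w => U w * W w) -> Ex Q (fun w => U w * W w) = 0.
Proof.
move=> sG mU U0 [iW W0] iUW.
pose TG := g_sigma_algebraType G.
have mU1 : measurable_fun (setT : set TG) (EFin \o U).
  by apply/(@measurable_EFinP _ TG).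
pose a := approx (setT : set TG) (EFin \o U).
have a_cvg w : a ^~ w @ \oo --> U w.
  by apply: (@cvg_approx _ TG R setT (EFin \o U)) => //=;
    rewrite ?ltry// => x _; rewrite lee_fin.
have a_le k w : a k w <= U w.
  by rewrite -lee_fin; apply: (@le_approx _ TG R setT (EFin \o U)) => // x _;
    rewrite lee_fin.
have a_ge0 k w : 0 <= a k w.
  by rewrite /a /approx addr_ge0 ?mulr_ge0// sumr_ge0// => i _;
    rewrite !mulr_ge0// ?invr_ge0 ?exprn_ge0.
pose A k j := dyadic_approx (setT : set TG) (EFin \o U) k j.
pose B k := integer_approx (setT : set TG) (EFin \o U) k.
have mA k j : <<s G>> (A k j).
  rewrite /A /dyadic_approx; case: ifPn => _; last exact: (@measurable0 _ TG).
  rewrite -preimage_comp; apply: mU1 => //.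
  by apply/measurable_image_EFin; exact: measurable_itv.
have mB k : <<s G>> (B k).
  rewrite /B /integer_approx; apply: (@emeasurable_fun_c_infty _ TG) => //.
have aE k w : a k w * W w = \sum_(j < k * 2 ^ k)
    (j%:R * 2 ^- k) * (W w * \1_(A k j) w) + k%:R * (W w * \1_(B k) w).
  rewrite /a /approx mulrDl mulr_suml -mulrA (mulrC _ (W w)); congr (_ + _).
  by apply: eq_bigr => j _; rewrite -/(A k j); ring.
have iA k j : intg Q (fun w => W w * \1_(A k j) w).
  by apply: intg_restr => //; exact: sG.
have iB k : intg Q (fun w => W w * \1_(B k) w).
  by apply: intg_restr => //; exact: sG.
have ia k : intg Q (fun w => a k w * W w).
  rewrite (funext (aE k)); apply: intgD; [apply: intg_sum => j _|]; exact: intgZ.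
have Ea k : Ex Q (fun w => a k w * W w) = 0.
  rewrite (funext (aE k)) ExD; [|by apply: intg_sum => j _; exact: intgZ|exact: intgZ].
  rewrite Ex_sum => [|j]; last exact: intgZ.
  by rewrite ExZ// W0// mulr0 addr0 big1// => j _; rewrite ExZ// W0// mulr0.
have : Ex Q (fun w => a k w * W w) @[k --> \oo] --> Ex Q (fun w => U w * W w).
  apply: (@Ex_dominated_cvg _ _ _ _ _ _ (fun w => `|U w * W w|)).
  - by move=> k; exact: (intg_measurable (ia k)).
  - apply: (intg_dom _ iUW) => [|w]; last by rewrite normr_id.
    by apply/measurableT_comp => //; exact: (intg_measurable iUW).
  - by move=> k w; rewrite !normrM ler_wpM2r// !ger0_norm.
  - by move=> w; apply: cvgM; [exact: a_cvg|exact: cvg_cst].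
under eq_fun do rewrite Ea.
by move/(cvg_unique (@norm_hausdorff _ _)); apply; exact: cvg_cst.
Qed.

(** U is split into positive and negative parts; their products with W stay integrable, being
    dominated by |U W|. *)
Lemma Ex_mul_centered G U W : <<s G>> `<=` measurable ->
  sub_measurable G U -> centered G W ->
  intg Q (fun w => U w * W w) -> Ex Q (fun w => U w * W w) = 0.
Proof.
move=> sG mU cW iUW; have [iW _] := cW.
have mp : sub_measurable G (fun w => Num.max (U w) 0) by exact: measurable_maxr.
have mn : sub_measurable G (fun w => Num.max (- U w) 0).
  by apply: measurable_maxr => //; exact: measurableT_comp.
have dom V : sub_measurable G V -> (forall w, `|V w| <= `|U w|) ->
    intg Q (fun w => V w * W w).
  move=> mV VU; apply: (intg_dom _ iUW) => [|w]; last by rewrite !normrM ler_wpM2r.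
  apply: measurable_funM; first exact: (sub_measurableW sG).
  exact: (intg_measurable iW).
have norm_max (x : R) : `|Num.max x 0| <= `|x|.
  by rewrite /Num.max; case: ifP => _; rewrite ?normr0.
have norm_maxN (x : R) : `|Num.max (- x) 0| <= `|x| by rewrite -(normrN x).
have ip := dom _ mp (fun w => norm_max (U w)).
have in_ := dom _ mn (fun w => norm_maxN (U w)).
have E : (fun w => U w * W w) =1
    (fun w => Num.max (U w) 0 * W w - Num.max (- U w) 0 * W w).
  by move=> w; rewrite -mulrBl; congr (_ * _); case: (lerP (U w) 0) => ?;
    case: lerP; lra.
have max0 (x : R) : 0 <= Num.max x 0 by rewrite le_max lexx orbT.
have zp := Ex_mul_centered_ge0 sG mp (fun w => max0 (U w)) cW ip.
have zn := Ex_mul_centered_ge0 sG mn (fun w => max0 (- U w)) cW in_.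
by rewrite (funext E) ExB// zp zn subrr.
Qed.

Lemma intg_mul_bounded U W (c : R) : measurable_fun setT U ->
  (forall w, `|U w| <= c) -> intg Q W -> intg Q (fun w => U w * W w).
Proof.
move=> mU Uc iW; apply: (intg_dom _ (intgZ c iW)) => [|w].
  by apply: measurable_funM => //; exact: (intg_measurable iW).
by rewrite !normrM ler_wpM2r// (le_trans (Uc w))// ler_norm.
Qed.

Lemma norm_indic_le1 A w : `|\1_A w| <= 1 :> R.
Proof. by rewrite indicE; case: (w \in A); rewrite ?normr1 ?normr0. Qed.

Lemma eq_Ex_off_null X Y A : measurable A -> Q A = 0%E ->
  intg Q X -> intg Q Y -> (forall w, ~ A w -> X w = Y w) -> Ex Q X = Ex Q Y.
Proof.
move=> mA QA iX iY XY; congr fine.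
apply: ae_eq_integral => //; [exact: measurable_int iX|exact: measurable_int iY|].
exists A; split => // w /=; apply: contra_notP => nA _; by rewrite XY.
Qed.

Lemma Ex_ge0_eq0 X : intg Q X -> (forall w, 0 <= X w) -> Ex Q X = 0 ->
  Q [set w | 0 < X w] = 0%E.
Proof.
move=> iX X0 EX0.
have mX := intg_measurable iX.
have mA : measurable [set w | 0 < X w].
  rewrite -[X in measurable X]setTI; have -> : [set w | 0 < X w] = X @^-1` `]0, +oo[.
    by apply/seteqP; split => w /=; rewrite in_itv /= andbT.
  exact: mX.
have : (\int[Q]_w `|(X w)%:E| = 0)%E.
  under eq_integral => w _ do rewrite gee0_abs ?lee_fin//.
  by rewrite ExE// EX0.
move/(ae_eq_integral_abs Q measurableT (measurable_int _ iX)) => [N [mN QN sN]].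
apply: (subset_measure0 mA mN) => // w /= Xw.
by apply: sN => /= /(_ I) [] Xw0; rewrite Xw0 ltxx in Xw.
Qed.

Lemma cexp_sub_measurable G Y Z : is_cexp Q <<s G>> Y Z -> sub_measurable G Z.
Proof. by case=> _ _ mZ _; apply/sub_measurableP. Qed.

Lemma cexp_centered G Y Z : <<s G>> `<=` measurable ->
  is_cexp Q <<s G>> Y Z -> centered G (fun w => Y w - Z w).
Proof.
move=> sG [iY iZ mZ YZ]; split=> [|A GA]; first exact: intgB.
have mA := sG _ GA.
under eq_Ex do rewrite mulrBl.
rewrite ExB; [|exact: intg_restr..].
apply/eqP; rewrite subr_eq0; apply/eqP.
by have := YZ A GA; rewrite (integral_restr _ Y mA) (integral_restr _ Z mA) =>
  E; rewrite /Ex /Rintegral E.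
Qed.

(** The exceptional set A lies in sigma(G), so Z - Z' and Y - Y' have the same integral over A. The
    latter is at most 0 while Z - Z' is positive on A, hence A is null. *)
Lemma cexp_le G Y Z Y' Z' : <<s G>> `<=` measurable ->
  is_cexp Q <<s G>> Y Z -> is_cexp Q <<s G>> Y' Z' ->
  (forall w, Y w <= Y' w) ->
  measurable [set w | Z' w < Z w] /\ Q [set w | Z' w < Z w] = 0%E.
Proof.
move=> sG cY cY' YY'; set A := [set w | _].
have [iY iZ _ _] := cY; have [iY' iZ' _ _] := cY'.
have GA : <<s G>> A.
  have /sub_measurableP mZZ : sub_measurable G (fun w => Z w - Z' w).
    by apply: measurable_funB; [exact: (cexp_sub_measurable cY)|exact:
      (cexp_sub_measurable cY')].
  have := mZZ `]0, +oo[%classic (measurable_itv _); congr (smallest _ _ _).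
  by apply/seteqP; split => w /=; rewrite /A /= in_itv/= andbT subr_gt0.
have mA := sG _ GA.
have [_ /(_ _ GA) E1] := cexp_centered sG cY.
have [_ /(_ _ GA) E2] := cexp_centered sG cY'.
pose h w := (Z w - Z' w) * \1_A w.
have ih : intg Q h by apply: intg_restr => //; exact: intgB.
have h0 w : 0 <= h w.
  rewrite /h indicE; case: (boolP (w \in A)) => [|_]; last by rewrite mulr0.
  by rewrite inE /A /= mulr1 subr_ge0 => /ltW.
have iYY : intg Q (fun w => (Y' w - Y w) * \1_A w).
  by apply: intg_restr => //; exact: intgB.
have Eh : Ex Q h = - Ex Q (fun w => (Y' w - Y w) * \1_A w).
  have i1 : intg Q (fun w => (Y w - Z w) * \1_A w) by apply: intg_restr => //;
    exact: intgB.
  have i2 : intg Q (fun w => (Y' w - Z' w) * \1_A w) by apply: intg_restr =>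
    //; exact: intgB.
  apply/eqP; rewrite -addr_eq0 -ExD//; apply/eqP.
  transitivity (Ex Q (fun w => (Y' w - Z' w) * \1_A w - (Y w - Z w) * \1_A w)).
    by apply: eq_Ex => w; rewrite /h; ring.
  by rewrite ExB// E1 E2 subrr.
have Eh0 : Ex Q h = 0.
  apply/eqP; rewrite eq_le; apply/andP; split.
    rewrite Eh oppr_le0 -(Ex_cst Q 0); apply: le_Ex => //; first exact: intg_cst.
    by move=> w /=; rewrite mulr_ge0 ?subr_ge0// indicE.
  by rewrite -(Ex_cst Q 0); apply: le_Ex => //; exact: intg_cst.
split=> //; rewrite -(Ex_ge0_eq0 ih h0 Eh0); congr (Q _).
apply/seteqP; split => w /=; rewrite /h indicE.
  by move=> Aw; rewrite mem_set// mulr1 subr_gt0.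
by case: (boolP (w \in A)) => [/set_mem//|_]; rewrite mulr0 ltxx.
Qed.

End Orthogonality.

Section ConditionalIndependence.
Context {d : measure_display} {T : measurableType d} {R : realType}.
Variable Q : probability T R.
Implicit Types (X Y Z U W : T -> R) (A B C : set T) (G : set (set T)).

Lemma cexp_cst G (a : R) : is_cexp Q <<s G>> (cst a) (cst a).
Proof.
split; [exact: intg_cst|exact: intg_cst| |by []].
by apply/sub_measurableP; exact: measurable_cst.
Qed.

(** [cond_indep] supplies separate versions for every pair of events, and a version need not be
    bounded. Clamping one of them to [0, 1] gives a reference version whose products with integrable
    functions stay integrable. *)
Lemma cexp_indic_clamp G C q1 : <<s G>> `<=` measurable -> measurable C ->
  is_cexp Q <<s G>> \1_C q1 ->
  exists q : T -> R, [/\ sub_measurable G q, forall w, `|q w| <= 1,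
    centered Q G (fun w => \1_C w - q w) &
    forall q', is_cexp Q <<s G>> \1_C q' ->
      exists N, [/\ measurable N, Q N = 0%E & forall w, ~ N w -> q' w = q w]].
Proof.
move=> sG mC cq1; pose q w := Num.max (Num.min (q1 w) 1) 0.
have mq : sub_measurable G q.
  apply: measurable_maxr => //; apply: measurable_minr => //.
  exact: (cexp_sub_measurable cq1).
have q_le1 w : `|q w| <= 1.
  by rewrite ger0_norm /q ?le_max ?lexx ?orbT// ge_max ge_min lexx orbT ler01.
have eq_q q' : is_cexp Q <<s G>> \1_C q' ->
    exists N, [/\ measurable N, Q N = 0%E & forall w, ~ N w -> q' w = q w].
  move=> cq'.
  have [m1 Q1] := cexp_le sG cq' cq1 (fun w => lexx _).
  have [m2 Q2] := cexp_le sG cq1 cq' (fun w => lexx _).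
  have le0 w : cst 0 w <= \1_C w :> R by rewrite indicE /=.
  have le1 w : \1_C w <= cst 1 w :> R.
    by rewrite indicE /=; case: (w \in C) => //=; exact: ler01.
  have [m3 Q3] := cexp_le sG (cexp_cst G 0) cq' le0.
  have [m4 Q4] := cexp_le sG cq' (cexp_cst G 1) le1.
  exists ([set w | q1 w < q' w] `|` [set w | q' w < q1 w] `|`
    ([set w | q' w < cst 0 w] `|` [set w | cst 1 w < q' w])); split.
  - by apply: measurableU; apply: measurableU.
  - by rewrite !null_set_setU//; apply: measurableU.
  - move=> w /not_orP[/not_orP[/= /negP h1 /negP h2] /not_orP[/= /negP h3 /negP h4]].
    rewrite -leNgt in h1; rewrite -leNgt in h2; rewrite -leNgt in h3;
      rewrite -leNgt in h4.
    have -> : q' w = q1 w by apply/eqP; rewrite eq_le h1 h2.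
    have E : q' w = q1 w by apply/eqP; rewrite eq_le h1 h2.
    by rewrite /q -E (min_idPl h4) (max_idPl h3).
have iq : intg Q q.
  apply: (intg_dom (sub_measurableW sG mq) (intg_cst Q 1)) => w.
  by rewrite /= normr1.
exists q; split => //; split=> [|A GA].
  by apply: intgB => //; exact: integrable_indic.
have [N [mN QN Nq]] := eq_q _ cq1.
have mA := sG _ GA.
have [_ /(_ _ GA) <-] := cexp_centered sG cq1.
have [_ iq1 _ _] := cq1.
apply: (eq_Ex_off_null mN QN).
- by apply: intg_restr => //; apply: intgB => //; exact: integrable_indic.
- by apply: intg_restr => //; apply: intgB => //; exact: integrable_indic.
- by move=> w /Nq ->.
Qed.

(** An intersection-stable family generating the join of the two sigma-algebras, as a Dynkin
    argument requires. *)
Definition rectangles G0 G1 : set (set T) :=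
  [set A | exists B C, [/\ <<s G0>> B, <<s G1>> C & A = B `&` C]].

Lemma sub_measurable_rectl G0 G1 X :
  sub_measurable G0 X -> sub_measurable (rectangles G0 G1) X.
Proof.
move=> /sub_measurableP mX; apply/sub_measurableP => B mB.
apply: sub_gen_smallest; exists (X @^-1` B), setT; split.
- exact: mX.
- exact: (@measurableT _ (g_sigma_algebraType G1)).
- by rewrite setIT.
Qed.

Lemma sub_measurable_rectr G0 G1 X :
  sub_measurable G1 X -> sub_measurable (rectangles G0 G1) X.
Proof.
move=> /sub_measurableP mX; apply/sub_measurableP => B mB.
apply: sub_gen_smallest; exists setT, (X @^-1` B); split.
- exact: (@measurableT _ (g_sigma_algebraType G0)).
- exact: mX.
- by rewrite setTI.
Qed.

Lemma sigma_rectangles_measurable G0 G1 :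
  <<s G0>> `<=` measurable -> <<s G1>> `<=` measurable ->
  <<s rectangles G0 G1>> `<=` @measurable _ T.
Proof.
move=> s0 s1; apply: smallest_sub; first exact: sigma_algebra_measurable.
by move=> _ [B [C [/s0 mB /s1 mC ->]]]; exact: measurableI.
Qed.

(** The sets over which W integrates to 0 form a Dynkin system. Complements use that the whole space
    is itself a rectangle, disjoint unions use countable additivity. *)
Lemma centered_rectangles G0 G1 W :
  <<s G0>> `<=` measurable -> <<s G1>> `<=` measurable -> intg Q W ->
  (forall B C, <<s G0>> B -> <<s G1>> C ->
     Ex Q (fun w => W w * \1_(B `&` C) w) = 0) ->
  centered Q (rectangles G0 G1) W.
Proof.
move=> s0 s1 iW W0; split=> //.
have sK := sigma_rectangles_measurable s0 s1.
have WT : Ex Q W = 0.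
  have := W0 setT setT (@measurableT _ (g_sigma_algebraType G0))
    (@measurableT _ (g_sigma_algebraType G1)).
  by rewrite setIT; under eq_Ex do rewrite indicT mulr1.
apply: (@dynkin_induction _ (g_sigma_algebraType (rectangles G0 G1))
  (rectangles G0 G1) (fun A => Ex Q (fun w => W w * \1_A w) = 0)).
- by [].
- move=> _ _ [B [C [GB GC ->]]] [B' [C' [GB' GC' ->]]].
  exists (B `&` B'), (C `&` C'); split.
  + exact: (@measurableI _ (g_sigma_algebraType G0)).
  + exact: (@measurableI _ (g_sigma_algebraType G1)).
  + by rewrite setIACA.
- by under eq_Ex do rewrite indicT mulr1.
- by move=> _ [B [C [GB GC ->]]]; exact: W0.
- move=> A mA A0; have mA1 : @measurable _ T A by exact: (sK _ mA).
  transitivity (Ex Q (fun w => W w - W w * \1_A w)).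
    apply: eq_Ex => w; rewrite indicC indicE.
    by case: (w \in A); rewrite /= ?mulr1 ?mulr0 ?subrr ?subr0.
  by rewrite ExB ?WT ?A0 ?subrr//; exact: intg_restr.
- move=> F mF tF F0.
  have mF1 k : @measurable _ T (F k) by exact: (sK _ (mF k)).
  have mU : @measurable _ T (\bigcup_k F k) by exact: bigcupT_measurable.
  rewrite /Ex /Rintegral -integral_restr// integral_bigcup//; last first.
    by apply: (integrableS measurableT) => //.
  rewrite eseries0// => k _ _.
  by rewrite integral_restr// ExE ?F0//; exact: intg_restr.
Qed.

End ConditionalIndependence.

Section CondIndepCentered.
Context {d : measure_display} {T : measurableType d} {R : realType}.
Variable Q : probability T R.
Implicit Types (X Y Z U W : T -> R) (A B C : set T) (G : set (set T)).

(** Conditional independence lifted from events to the integrable W, that is, E[W | G0, G1] =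
    E[W | G0]. On a rectangle the indicator of C is traded for its conditional probability q. *)
Lemma cond_indep_centered G0 G1 G2 W g :
  <<s G0>> `<=` measurable -> <<s G1>> `<=` measurable ->
  <<s G2>> `<=` measurable ->
  cond_indep Q <<s G0>> <<s G1>> <<s G2>> ->
  sub_measurable G2 W -> is_cexp Q <<s G0>> W g ->
  centered Q (rectangles G0 G1) (fun w => W w - g w).
Proof.
move=> s0 s1 s2 ind mW cW.
have [iW ig _ _] := cW.
have mg := cexp_sub_measurable cW.
apply: centered_rectangles => //; first exact: intgB.
move=> B C GB GC.
have [mB mC] := (s0 _ GB, s1 _ GC).
have T2 : <<s G2>> setT by exact: (@measurableT _ (g_sigma_algebraType G2)).
(* The partner event [setT] is an arbitrary choice; only some version of P(C | G0) is wanted. *)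
have [q1 [_ [cq1 _ _]]] := ind C setT GC T2.
have [q [mq q_le1 cq eq_q]] := cexp_indic_clamp s0 mC cq1.
have [iCq _] := cq.
have mq' := sub_measurableW s0 mq.
have mB0 : sub_measurable G0 (\1_B : T -> R) by exact: (@measurable_indic _
  (g_sigma_algebraType G0)).
have mU : sub_measurable G0 (fun w => \1_B w * q w) by exact: measurable_funM.
have mU' := sub_measurableW s0 mU.
have U_le1 w : `|\1_B w * q w| <= 1.
  by rewrite normrM mulr_ile1// norm_indic_le1.
have mind A : measurable A -> measurable_fun setT (\1_A : T -> R).
  by move=> mA; exact: measurable_indic.
have iind A : measurable A -> intg Q (\1_A : T -> R).
  by move=> mA; exact: integrable_indic.
(* Given C, the indicator of C may be replaced by q against any
   sigma(G2)-measurable factor, hence against W. *)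
pose v w : R := \1_B w * (\1_C w - q w).
have mv : measurable_fun setT v.
  by apply: measurable_funM; [exact: mind|apply: measurable_funB => //; exact: mind].
have iv : intg Q v.
  by apply: (intg_mul_bounded (mind _ mB) (@norm_indic_le1 _ _ _ _)) => //.
have cv : centered Q G2 v.
  split=> // D GD; have mD := s2 _ GD.
  (* The version q1' may depend on D, so it is exchanged for q off a null set before q2 is turned
     back into the indicator of D. *)
  have [q1' [q2 [cq1' cq2 [iCD iqq mqq Eqq]]]] := ind C D GC GD.
  have [N [mN QN Nq]] := eq_q _ cq1'.
  have [_ iq2 _ _] := cq2.
  have iBqD : intg Q (fun w => \1_B w * q w * \1_D w).
    by apply: (intg_mul_bounded mU' U_le1); exact: iind.
  have iBqq2 : intg Q (fun w => \1_B w * q w * q2 w).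
    exact: (intg_mul_bounded mU' U_le1).
  have iBCD : intg Q (fun w => \1_B w * \1_(C `&` D) w).
    by apply: (intg_mul_bounded (mind _ mB) (@norm_indic_le1 _ _ _ _)) => //.
  have iBqq : intg Q (fun w => \1_B w * (q1' w * q2 w)).
    by apply: (intg_mul_bounded (mind _ mB) (@norm_indic_le1 _ _ _ _)) => //.
  have E1 : Ex Q (fun w => \1_B w * \1_(C `&` D) w) = Ex Q (fun w => \1_B w *
    (q1' w * q2 w)).
    have := Eqq _ GB; rewrite (integral_restr _ _ mB) (integral_restr _ (q1' \*
      q2) mB) => E.
    transitivity (Ex Q (fun w => \1_(C `&` D) w * \1_B w)).
      by apply: eq_Ex => w; rewrite mulrC.
    rewrite /Ex /Rintegral E; congr fine; apply: eq_integral => w _.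
    by rewrite mulrC.
  have E2 : Ex Q (fun w => \1_B w * (q1' w * q2 w)) = Ex Q (fun w => \1_B w * q
    w * q2 w).
    by apply: (eq_Ex_off_null mN QN) => // w /Nq ->; rewrite mulrA.
  have E3 : Ex Q (fun w => \1_B w * q w * \1_D w - \1_B w * q w * q2 w) = 0.
    under eq_Ex do rewrite -mulrBr.
    apply: (Ex_mul_centered s0 mU (cexp_centered s0 cq2)).
    by apply: (intg_mul_bounded mU' U_le1); apply: intgB => //; exact: iind.
  transitivity (Ex Q (fun w => \1_B w * \1_(C `&` D) w - \1_B w * q w * \1_D w)).
    by apply: eq_Ex => w; rewrite /v indicI /=; ring.
  rewrite ExB// E1 E2; apply/eqP; rewrite subr_eq0 eq_sym -subr_eq0; apply/eqP.
  by rewrite -E3 ExB.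
have v_le w : `|v w| <= 1 + 1.
  rewrite normrM -[leRHS]mul1r ler_pM ?norm_indic_le1//.
  by rewrite (le_trans (ler_normB _ _))// lerD// norm_indic_le1.
have iWv : intg Q (fun w => W w * v w).
  by apply: intg_eq (intg_mul_bounded mv v_le iW) => w; rewrite mulrC.
have EWv := Ex_mul_centered s2 mW cv iWv.
have iBg : intg Q (fun w => \1_B w * g w).
  by apply: (intg_mul_bounded (mind _ mB) (@norm_indic_le1 _ _ _ _)).
have iBgCq : intg Q (fun w => \1_B w * g w * (\1_C w - q w)).
  by apply: intg_eq (intg_mul_bounded mv v_le ig) => w; rewrite /v; ring.
have EBg := Ex_mul_centered s0 (measurable_funM mB0 mg) cq iBgCq.
have iUW : intg Q (fun w => \1_B w * q w * (W w - g w)).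
  by apply: (intg_mul_bounded mU' U_le1); exact: intgB.
have EUW := Ex_mul_centered s0 mU (cexp_centered s0 cW) iUW.
(* Each of the three terms has mean zero: v is centered given G2, while W - g and 1_C - q are
   centered given G0. *)
transitivity (Ex Q (fun w => W w * v w + \1_B w * q w * (W w - g w)
    - \1_B w * g w * (\1_C w - q w))).
  by apply: eq_Ex => w; rewrite indicI /v /=; ring.
by rewrite ExB ?ExD ?EWv ?EUW ?EBg ?addr0 ?subr0//; exact: intgD.
Qed.

End CondIndepCentered.

(** * Measurability of the direction *)

Section MeasurableMatrices.
Context {d : measure_display} {T : measurableType d} {R : realType}.

(* The countably-valued maps floor((k+1) Y) / (k+1) converge to Y, so F only needs
   to be continuous at the values of Y. *)
Lemma measurable_continuous_rV n (F : 'rV[R]_n -> R) (Y : T -> 'rV[R]_n) :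
  measurable_mx Y -> (forall w, {for Y w, continuous F}) ->
  measurable_fun setT (fun w => F (Y w)).
Proof.
move=> mY cF.
pose K k w : 'rV[int]_n := \row_j Num.floor (k.+1%:R * Y w 0 j).
pose r k (v : 'rV[int]_n) : 'rV[R]_n := \row_j ((v 0 j)%:~R / k.+1%:R).
have mK k v : measurable (K k @^-1` [set v]).
  have -> : K k @^-1` [set v] = \bigcap_(j in [set: 'I_n])
      ((fun w => k.+1%:R * Y w 0 j) @^-1` `[(v 0 j)%:~R, (v 0 j + 1)%:~R[%classic).
    apply/seteqP; split => w /=.
      by move=> /rowP Kv j _ /=; rewrite -Kv mxE in_itv /= floor_itv.
    move=> h; apply/rowP => j; rewrite mxE; apply: floor_def.
    by have := h j I; rewrite /= in_itv.
  apply: fin_bigcap_measurable => [|j _]; first exact: finite_finset.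
  rewrite -[X in measurable X]setTI.
  have mf : measurable_fun setT (fun w => k.+1%:R * Y w 0 j).
    by apply: measurable_funM; [exact: measurable_cst|exact: mY].
  by apply: mf => //; exact: measurable_itv.
apply: (@measurable_fun_cvg _ _ _ _ (fun k w => F (r k (K k w)))).
- move=> k _ B mB; rewrite setTI.
  have -> : (fun w => F (r k (K k w))) @^-1` B =
      \bigcup_(v in [set: 'rV[int]_n]) (if F (r k v) \in B then K k @^-1` [set
        v] else set0).
    apply/seteqP; split => [w Bw|w [v _]] /=.
      by exists (K k w) => //; rewrite mem_set.
    by case: ifPn => // /set_mem Bv /= ->.
  by apply: countable_bigcupT_measurable => // v; case: ifP.
- move=> w _; apply: (@cvg_comp _ _ _ (fun k => r k (K k w)) F); last exact: cF.
  apply/cvg_ballP => e e0; near=> k; split=> // i j; rewrite /ball /=.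
  rewrite !mxE (ord1 i).
  have k0 : (0 : R) < k.+1%:R by [].
  have /andP[h1 h2] : (Num.floor (k.+1%:R * Y w 0 j))%:~R <= k.+1%:R * Y w 0 j
       < (Num.floor (k.+1%:R * Y w 0 j) + 1)%:~R by exact: floor_itv.
  have -> : Y w 0 j - (Num.floor (k.+1%:R * Y w 0 j))%:~R / k.+1%:R =
     (k.+1%:R * Y w 0 j - (Num.floor (k.+1%:R * Y w 0 j))%:~R) / k.+1%:R.
    by field; rewrite gt_eqF.
  rewrite ger0_norm ?divr_ge0 ?subr_ge0//.
  apply: (@le_lt_trans _ _ k.+1%:R^-1).
    by rewrite ler_pdivrMr// mulVf ?gt_eqF// lerBlDl; move: h2; rewrite intrD => /ltW.
  by near: k; exact: near_infty_natSinv_lt (PosNum e0).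
Unshelve. all: by end_near. Qed.

Lemma measurable_inv (f : T -> R) : measurable_fun setT f ->
  measurable_fun setT (fun w => (f w)^-1).
Proof.
(* Squaring makes the base nonnegative, where the real power -1 is the inverse; at 0 both sides
   vanish because 0^-1 = 0. *)
move=> mf; have -> : (fun w => (f w)^-1) = (fun w => f w * (f w ^+ 2) `^ (-1)).
  apply/funext => w; rewrite powR_inv1 ?sqr_ge0// expr2.
  have [->|f0] := eqVneq (f w) 0; first by rewrite mul0r invr0.
  by field.
apply: measurable_funM => //.
apply: (measurableT_comp (measurable_powR _)).
exact: measurable_funX.
Qed.

Lemma measurable_mulmx m n k (A : T -> 'M[R]_(m, n)) (B : T -> 'M[R]_(n, k)) :
  measurable_mx A -> measurable_mx B -> measurable_mx (fun w => A w *m B w).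
Proof.
move=> mA mB i j.
rewrite (_ : (fun w => _) = (fun w => \sum_l A w i l * B w l j)).
  by apply: measurable_sum => l; apply: measurable_funM; [exact: mA|exact: mB].
by apply/funext => w; rewrite mxE.
Qed.

Lemma measurable_trmx m n (A : T -> 'M[R]_(m, n)) :
  measurable_mx A -> measurable_mx (fun w => (A w)^T).
Proof.
move=> mA i j; rewrite (_ : (fun w => _) = (fun w => A w j i)); first exact: mA.
by apply/funext => w; rewrite mxE.
Qed.

Lemma measurable_addmx m n (A B : T -> 'M[R]_(m, n)) :
  measurable_mx A -> measurable_mx B -> measurable_mx (fun w => A w + B w).
Proof.
move=> mA mB i j; rewrite (_ : (fun w => _) = (fun w => A w i j + B w i j)).
  by apply: measurable_funD; [exact: mA|exact: mB].
by apply/funext => w; rewrite mxE.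
Qed.

Lemma measurable_oppmx m n (A : T -> 'M[R]_(m, n)) :
  measurable_mx A -> measurable_mx (fun w => - A w).
Proof.
move=> mA i j; rewrite (_ : (fun w => _) = (fun w => - A w i j)).
  by apply: measurableT_comp => //; exact: mA.
by apply/funext => w; rewrite mxE.
Qed.

Lemma measurable_det n (A : T -> 'M[R]_n) : measurable_mx A ->
  measurable_fun setT (fun w => \det (A w)).
Proof.
move=> mA; apply: measurable_sum => s; apply: measurable_funM => //.
by apply: measurable_prod => i _; exact: mA.
Qed.

(** Cramer's rule: the entries are cofactors over the determinant. Invertibility at every point
    excludes the default value of [invmx]. *)
Lemma measurable_invmx n (A : T -> 'M[R]_n) : measurable_mx A ->
  (forall w, A w \in unitmx) -> measurable_mx (fun w => invmx (A w)).
Proof.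
move=> mA uA i j.
rewrite (_ : (fun w => _) = (fun w => (\det (A w))^-1 *
    ((-1) ^+ (j + i) * \det (row' j (col' i (A w)))))); last first.
  by apply/funext => w; rewrite /invmx uA !mxE.
apply: measurable_funM; first by apply: measurable_inv; exact: measurable_det.
apply: measurable_funM => //; apply: measurable_det => k l.
rewrite (_ : (fun w => _) = (fun w => A w (lift j k) (lift i l))); first exact: mA.
by apply/funext => w; rewrite !mxE.
Qed.

Lemma measurable_dotv n (u v : T -> 'rV[R]_n) :
  measurable_mx u -> measurable_mx v ->
  measurable_fun setT (fun w => dotv (u w) (v w)).
Proof.
move=> mu mv; apply: measurable_sum => i.
by apply: measurable_funM; [exact: mu|exact: mv].
Qed.

Lemma measurable_block_mx m1 m2 n1 n2 (A : T -> 'M[R]_(m1, n1)) (B : T ->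
  'M[R]_(m1, n2))
    (C : T -> 'M[R]_(m2, n1)) (D : T -> 'M[R]_(m2, n2)) :
  measurable_mx A -> measurable_mx B -> measurable_mx C -> measurable_mx D ->
  measurable_mx (fun w => block_mx (A w) (B w) (C w) (D w)).
Proof.
move=> mA mB mC mD i j.
rewrite -(fintype.splitK i) -(fintype.splitK j); case: (fintype.split i) => k;
  case: (fintype.split j) => l /=.
- by under eq_fun do rewrite block_mxEul; exact: mA.
- by under eq_fun do rewrite block_mxEur; exact: mB.
- by under eq_fun do rewrite block_mxEdl; exact: mC.
- by under eq_fun do rewrite block_mxEdr; exact: mD.
Qed.

Lemma measurable_kkt n m (H : T -> 'M[R]_n) (J : T -> 'M[R]_(m, n)) (zeta : R) :
  0 < zeta -> (forall w sv, singular_value (J w) sv -> 0 < sv) ->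
  (forall w (u : 'rV[R]_n), u *m (J w)^T = 0 ->
     zeta * norm2 u ^+ 2 <= dotv (u *m H w) u) ->
  measurable_mx H -> measurable_mx J ->
  measurable_mx (fun w => kktA (H w) (J w)) /\
  measurable_mx (fun w => kktB (H w) (J w)).
Proof.
move=> z0 Jsv Hc mH mJ; have mJT := measurable_trmx mJ.
rewrite /kktA /kktB; case: leqP => [mn|nm].
  have mI : measurable_mx (fun w => kkt_inv (H w) (J w)).
    apply: measurable_invmx => [|w]; last exact: (kkt_unitmx z0 (Jsv w) (Hc w)).
    by apply: measurable_block_mx => // i j; exact: measurable_cst.
  split=> i j.
    by under eq_fun do rewrite mxE mxE; exact: mI.
  by under eq_fun do rewrite mxE mxE; exact: mI.
split=> [i j|]; first exact: measurable_cst.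
apply: measurable_mulmx => //; apply: measurable_invmx => [|w].
  exact: measurable_mulmx.
exact: (gram_unitmx (Jsv w)).
Qed.

End MeasurableMatrices.

(** * Square-integrable random vectors *)

Section CondProb.
Context {d : measure_display} {T : measurableType d} {R : realType}.

Lemma cond_prob_setC (P : probability T R) (E : set T) (mE : measurable E) :
  (0 < P E)%E -> cond_prob P mE (~` E) = 0%E.
Proof.
move=> PE0; rewrite /cond_prob /= /mnormalize /= /mrestr setTI.
have -> : (P E == 0)%E = false by apply/negbTE; rewrite gt_eqF.
have -> : (P E == +oo)%E = false.
  by apply/negbTE; rewrite lt_eqF// (le_lt_trans (probability_le1 _ mE))// ltry.
by rewrite /= setICl measure0 mul0e.
Qed.

End CondProb.

Section OnFullEvent.
Context {d : measure_display} {T : measurableType d} {R : realType}.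
Variables (Q : probability T R) (E : set T).
Hypotheses (mE : measurable E) (QE : Q (~` E) = 0%E).

(** Prepares for the bounds on Delta l, which are available on the merit event only: as E has full
    measure, domination may be checked on E alone. *)
Lemma intg_dom_on (X Y : T -> R) : measurable_fun setT X -> intg Q Y ->
  (forall w, E w -> `|X w| <= `|Y w|) -> intg Q X.
Proof.
move=> mX iY XY.
have mX' : measurable_fun setT (EFin \o X) by exact/measurable_EFinP.
apply/(negligible_integrable (measurableC mE) measurableT mX' QE).
rewrite setDE setTI setCK.
apply: (le_integrable mE) (integrableS measurableT mE _ iY) => //.
exact: measurable_funTS.
Qed.

Lemma le_Ex_on (X Y : T -> R) : intg Q X -> intg Q Y ->
  (forall w, E w -> X w <= Y w) -> Ex Q X <= Ex Q Y.
Proof.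
move=> iX iY XY.
have E0 (Z : T -> R) : intg Q Z -> Ex Q Z = Ex Q (fun w => Z w * \1_E w).
  move=> iZ; apply: (eq_Ex_off_null (measurableC mE) QE) => //.
    exact: intg_restr.
  by move=> w /= /contrapT Ew; rewrite indicE mem_set// mulr1.
rewrite (E0 _ iX) (E0 _ iY); apply: le_Ex; [exact: intg_restr..|move=> w].
rewrite indicE; case: (boolP (w \in E)) => [/set_mem/XY|_].
  by rewrite !mulr1.
by rewrite !mulr0.
Qed.

Definition L2v n (V : T -> 'rV[R]_n) : Prop :=
  measurable_mx V /\ intg Q (fun w => dotv (V w) (V w)).

Lemma L2v_dom n (V : T -> 'rV[R]_n) (Y : T -> R) : measurable_mx V ->
  intg Q Y -> (forall w, E w -> dotv (V w) (V w) <= Y w) -> L2v V.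
Proof.
move=> mV iY VY; split=> //; apply: (intg_dom_on _ iY) => [|w Ew].
  exact: measurable_dotv.
by rewrite ger0_norm ?dotv_ge0// (le_trans (VY _ Ew))// ler_norm.
Qed.

Lemma L2vD n (U V : T -> 'rV[R]_n) : L2v U -> L2v V -> L2v (fun w => U w + V w).
Proof.
move=> [mU iU] [mV iV].
apply: (@L2v_dom _ _ (fun w => 2 * dotv (U w) (U w) + 2 * dotv (V w) (V w))).
- exact: measurable_addmx.
- by apply: intgD; exact: intgZ.
- move=> w _; have := dotv_ge0 (U w - V w).
  rewrite !(dotvDl, dotvDr, dotvNl, dotvNr); lra.
Qed.

Lemma L2vZ n (a : R) (U : T -> 'rV[R]_n) : L2v U -> L2v (fun w => a *: U w).
Proof.
move=> [mU iU]; split.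
  move=> i j; rewrite (_ : (fun w => _) = (fun w => a * U w i j)).
    by apply: measurable_funM => //; exact: mU.
  by apply/funext => w; rewrite mxE.
apply: intg_eq (intgZ (a ^+ 2) iU) => w.
by rewrite dotvZl dotvZr mulrA -expr2.
Qed.

Lemma coord_sqr_le n (u : 'rV[R]_n) i : u 0 i ^+ 2 <= dotv u u.
Proof.
rewrite /dotv (bigD1 i)//= expr2 lerDl.
by apply: sumr_ge0 => j _; rewrite -expr2 sqr_ge0.
Qed.

Lemma L2v_coordM n (U V : T -> 'rV[R]_n) i j : L2v U -> L2v V ->
  intg Q (fun w => U w 0 i * V w 0 j).
Proof.
move=> [mU iU] [mV iV].
apply: (intg_dom_on _ (intgD iU iV)) => [|w _].
  by apply: measurable_funM; [exact: mU|exact: mV].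
rewrite [leRHS]ger0_norm ?addr_ge0 ?dotv_ge0// normrM.
have := coord_sqr_le (U w) i; have := coord_sqr_le (V w) j.
have := dotv_ge0 (U w); have := dotv_ge0 (V w).
rewrite -[U w 0 i ^+ 2]real_normK ?num_real// -[V w 0 j ^+ 2]real_normK ?num_real//.
have := sqr_ge0 (`|U w 0 i| - `|V w 0 j|); nra.
Qed.

Lemma L2v_dot n (U V : T -> 'rV[R]_n) : L2v U -> L2v V ->
  intg Q (fun w => dotv (U w) (V w)).
Proof. by move=> lU lV; apply: intg_sum => i _; exact: L2v_coordM. Qed.

Lemma L2v_bounded n (V : T -> 'rV[R]_n) (c : R) : measurable_mx V ->
  (forall w, E w -> norm2 (V w) <= c) -> L2v V.
Proof.
move=> mV Vc; apply: (@L2v_dom _ _ (cst (c ^+ 2))) => [//||w /Vc h].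
  exact: intg_cst.
by rewrite -norm2_sqr /= ler_sqr ?nnegrE ?(le_trans _ h) ?norm2_ge0.
Qed.

Lemma Ex_dotv_centered G n (U W : T -> 'rV[R]_n) :
  <<s G>> `<=` measurable -> (forall j, sub_measurable G (fun w => U w 0 j)) ->
  (forall j, centered Q G (fun w => W w 0 j)) -> L2v U -> L2v W ->
  Ex Q (fun w => dotv (U w) (W w)) = 0.
Proof.
move=> sG mU cW lU lW; rewrite Ex_sum => [|j]; last exact: L2v_coordM.
by rewrite big1// => j _; apply: (Ex_mul_centered sG) => //; exact: L2v_coordM.
Qed.

End OnFullEvent.

Section SigmaMx.
Context {d : measure_display} {T : measurableType d} {R : realType}.

(** The generators inside [sigma_mx], named because the results on [centered] take a generating
    family; [<<s gen_mx Y>>] is [sigma_mx Y] by unfolding. *)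
Definition gen_mx m n (Y : T -> 'M[R]_(m, n)) : set (set T) :=
  \bigcup_(ij in [set: 'I_m * 'I_n])
    preimage_set_system setT (fun w => Y w ij.1 ij.2) measurable.

Lemma sigma_mx_measurable m n (Y : T -> 'M[R]_(m, n)) :
  measurable_mx Y -> <<s gen_mx Y>> `<=` @measurable _ T.
Proof.
move=> mY; apply: smallest_sub; first exact: sigma_algebra_measurable.
by move=> _ [[i j] _ [B mB <-]]; exact: mY.
Qed.

Lemma sub_measurable_gen_mx m n (Y : T -> 'M[R]_(m, n)) i j :
  sub_measurable (gen_mx Y) (fun w => Y w i j).
Proof.
apply/sub_measurableP => B mB; apply: sub_gen_smallest.
by exists (i, j) => //; exists B => //; rewrite setTI.
Qed.

End SigmaMx.

(** * Bounds and measurability of the problem functions along the iterates *)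

Section Bounds.
Context {R : realType} {n m N : nat} (p : problem R n m N).
Context (X : set 'rV[R]_n) (L : R) (gam : 'I_m -> R).
Hypothesis smooth : smoothness p X L gam.

Lemma bounded_ex (U : Type) (V : normedModType R) (f : U -> V) (A : set U) :
  [bounded f x | x in A] -> exists2 M, 0 <= M & forall x, A x -> `|f x| <= M.
Proof.
move=> bf.
have [M [M0 hM]] := filter_ex (filterI (nbhs_pinfty_ge (num_real (0 : R))) bf).
by exists M.
Qed.

Lemma norm2_le_mx_norm k (u : 'rV[R]_k) : norm2 u <= k%:R * `|u|.
Proof.
rewrite -(@ler_pXn2r _ 2)// ?nnegrE ?norm2_ge0 ?mulr_ge0//.
rewrite norm2_sqr /dotv.
apply: (@le_trans _ _ (\sum_(i < k) `|u| ^+ 2)).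
  apply: ler_sum => i _; rewrite -expr2 -[u 0 i ^+ 2]real_normK ?num_real//.
  rewrite lerXn2r ?nnegrE//.
  rewrite [`|u|]mx_normrE; exact: (le_bigmax _ (fun ij => `|u ij.1 ij.2|) (0, i)).
rewrite sumr_const card_ord exprMn -[leLHS]mulr_natl ler_wpM2r ?sqr_ge0//.
by rewrite -natrX ler_nat -mulnn; case: k {u} => // k; rewrite leq_pmulr.
Qed.

Lemma grad_objective_bound :
  exists M, forall x, X x -> norm2 (grad (objective p) x) <= M.
Proof.
have [M M0 hM] := bounded_ex (gradf_bounded smooth).
exists (n%:R * M) => x Xx; rewrite (le_trans (norm2_le_mx_norm _))//.
by rewrite ler_wpM2l// hM.
Qed.

Lemma constr_norm1_bound : exists M, forall x, X x -> norm1 (constr p x) <= M.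
Proof.
have hM i : exists M, forall x, X x -> `|constr p x 0 i| <= M.
  by have [M _ hM] := bounded_ex (c_bounded smooth i); exists M.
have [M hM'] := choice hM.
by exists (\sum_i M i) => x Xx; apply: ler_sum => i _; exact: hM'.
Qed.

Lemma merit_bound tau : 0 <= tau ->
  exists M, forall x, X x -> `|merit p x tau| <= M.
Proof.
move=> t0; have [Mc hMc] := constr_norm1_bound.
have [M M0 hM] := bounded_ex (f_bounded smooth).
exists (tau * M + Mc) => x Xx; rewrite (le_trans (ler_normD _ _))// lerD//.
  by rewrite normrM (ger0_norm t0) ler_wpM2l// hM.
by rewrite ger0_norm ?hMc// sumr_ge0.
Qed.

Lemma continuous_constr i x : X x -> {for x, continuous (constr_i p i)}.
Proof.
by move=> /(c_C1 smooth i)[h _]; exact: differentiable_continuous.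
Qed.

Lemma continuous_objective x : X x -> {for x, continuous (objective p)}.
Proof.
by move=> Xx; apply: differentiable_continuous;
  exact: (differentiable_objective smooth).
Qed.

Lemma continuous_jac i j x : X x -> {for x, continuous (fun y => jac p y i j)}.
Proof.
move=> /(c_C1 smooth i)[_ h].
rewrite (_ : (fun y => _) = (fun v : 'rV[R]_n => v 0 j) \o grad (constr_i p i)).
  by apply: continuous_comp h _; exact: coord_continuous.
by apply/funext => y; rewrite mxE.
Qed.

Lemma jac_singular_value_gt0 x sv : X x -> singular_value (jac p x) sv -> 0 < sv.
Proof.
by have [e e0 h] := J_singular_values smooth => Xx /(h _ _ Xx); exact: lt_le_trans.
Qed.

Context {d : measure_display} {T : measurableType d} (x : T -> 'rV[R]_n).
Hypotheses (Xx : forall w, X (x w)) (mx : measurable_mx x).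

Lemma measurable_constr : measurable_mx (fun w => constr p (x w)).
Proof.
move=> i j; rewrite ord1.
apply: (measurable_continuous_rV mx (F := constr_i p j)) => w.
exact: continuous_constr.
Qed.

Lemma measurable_jac : measurable_mx (fun w => jac p (x w)).
Proof.
move=> i j; apply: (measurable_continuous_rV mx (F := fun y => jac p y i j)) => w.
exact: continuous_jac.
Qed.

Lemma measurable_norm1 k (v : T -> 'rV[R]_k) : measurable_mx v ->
  measurable_fun setT (fun w => norm1 (v w)).
Proof.
by move=> mv; apply: measurable_sum => i; apply: measurableT_comp => //; exact: mv.
Qed.

Lemma measurable_merit tau : measurable_fun setT (fun w => merit p (x w) tau).
Proof.
apply: measurable_funD; last exact/measurable_norm1/measurable_constr.
apply: measurable_funM => //.
by apply: (measurable_continuous_rV mx) => w; exact: continuous_objective.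
Qed.

End Bounds.

(** * One inner iteration *)

Section Step.
Context {R : realType} {n m N : nat} (p : problem R n m N).
Context (X : set 'rV[R]_n) (L : R) (gam : 'I_m -> R).
Context {d : measure_display} {T : measurableType d}.
Variables (Q : probability T R) (E : set T) (b : nat).
Variables (zeta kl tau alpha : R).
Variables (x0 x gb db dt : T -> 'rV[R]_n) (yb yt : T -> 'rV[R]_m).
Variable H : T -> 'M[R]_n.

Let g w := grad (objective p) (x w).
Let noise w := gb w - g w.
Let R0 := gen_mx (fun w => row_mx (x0 w) (x w)).
(** Generates the joint sigma-algebra of x0, x and H, on which the true direction and the matrices A
    and B depend. *)
Let F := rectangles R0 (gen_mx H).

Hypotheses (smooth : smoothness p X L gam) (N_gt0 : (0 < N)%N).
Hypotheses (b_gt0 : (0 < b)%N).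
Hypotheses (zeta_gt0 : 0 < zeta) (kl_gt0 : 0 < kl) (tau_gt0 : 0 < tau).
Hypothesis alpha01 : 0 < alpha <= 1.
Hypotheses (mE : measurable E) (QE : Q (~` E) = 0%E).
Hypotheses (Xx : forall w, X (x w)) (Xn : forall w, X (x w + alpha *: db w)).
Hypotheses (mx0 : measurable_mx x0) (mx : measurable_mx x).
Hypotheses (mH : measurable_mx H) (mdb : measurable_mx db).
Hypothesis H_curv : forall w (u : 'rV[R]_n), u *m (jac p (x w))^T = 0 ->
  zeta * norm2 u ^+ 2 <= dotv (u *m H w) u.
Hypothesis kkt_b : forall w, kkt p (H w) (x w) (gb w) (db w) (yb w).
Hypothesis kkt_t : forall w, kkt p (H w) (x w) (g w) (dt w) (yt w).
Hypothesis dl_t : forall w, E w ->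
  kl * tau * norm2 (dt w) ^+ 2 <= delta_l p (x w) tau (g w) (dt w).
Hypothesis dl_b : forall w, E w ->
  kl * tau * norm2 (db w) ^+ 2 <= delta_l p (x w) tau (gb w) (db w).
Hypothesis gb_cexp : forall i,
  is_cexp Q <<s R0>> (fun w => gb w 0 i) (fun w => g w 0 i).
Hypothesis gb_var : exists2 V : T -> R,
  is_cexp Q <<s R0>> (fun w => norm2 (gb w - g w) ^+ 2) V &
  {ae Q, forall w, V w <= L ^+ 2 / b%:R * norm2 (x w - x0 w) ^+ 2}.
Hypothesis H_indep : cond_indep Q <<s R0>> <<s gen_mx H>> <<s gen_mx gb>>.
Hypothesis L2_dist : L2v Q (fun w => x w - x0 w).

Let A w := kktA (H w) (jac p (x w)).
Let B w := kktB (H w) (jac p (x w)).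

Lemma measurable_iterates : measurable_mx (fun w => row_mx (x0 w) (x w)).
Proof.
move=> i j; rewrite (ord1 i) -(fintype.splitK j); case: (fintype.split j) => k /=.
  by under eq_fun do rewrite row_mxEl; exact: mx0.
by under eq_fun do rewrite row_mxEr; exact: mx.
Qed.

Lemma measurable_estimate : measurable_mx gb.
Proof.
by move=> i j; rewrite ord1; have [ig _ _ _] := gb_cexp j; exact: (intg_measurable ig).
Qed.

Lemma sigma_iterates_measurable : <<s R0>> `<=` @measurable _ T.
Proof. exact: sigma_mx_measurable measurable_iterates. Qed.

Lemma sigma_history_measurable : <<s F>> `<=` @measurable _ T.
Proof.
by apply: sigma_rectangles_measurable;
  [exact: sigma_iterates_measurable|exact: sigma_mx_measurable].
Qed.

Lemma history_measurable_x j : sub_measurable F (fun w => x w 0 j).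
Proof.
apply: sub_measurable_rectl.
rewrite (_ : (fun w => _) = (fun w => row_mx (x0 w) (x w) 0 (rshift n j))).
  exact: (@sub_measurable_gen_mx _ T R _ _ (fun w => row_mx (x0 w) (x w)) 0
    (rshift n j)).
by apply/funext => w; rewrite row_mxEr.
Qed.

Lemma history_measurable_x0 j : sub_measurable F (fun w => x0 w 0 j).
Proof.
apply: sub_measurable_rectl.
rewrite (_ : (fun w => _) = (fun w => row_mx (x0 w) (x w) 0 (lshift n j))).
  exact: (@sub_measurable_gen_mx _ T R _ _ (fun w => row_mx (x0 w) (x w)) 0
    (lshift n j)).
by apply/funext => w; rewrite row_mxEl.
Qed.

Lemma history_measurable_g j : sub_measurable F (fun w => g w 0 j).
Proof. by apply: sub_measurable_rectl; apply: (cexp_sub_measurable (gb_cexp j)). Qed.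

Let TF := g_sigma_algebraType F.

(** The measurability lemmas hold over any measurable space; here they are applied to T with the
    coarser sigma-algebra generated by F. *)
Lemma history_measurable_kkt : @measurable_mx _ TF R _ _ A /\ @measurable_mx _
  TF R _ _ B.
Proof.
have mxF : @measurable_mx _ TF R _ _ x by move=> i j; rewrite ord1;
  exact: history_measurable_x.
apply: (@measurable_kkt _ TF _ _ _ H (fun w => jac p (x w)) zeta) => //.
- by move=> w sv; exact: (jac_singular_value_gt0 smooth (Xx w)).
- move=> i j; apply: sub_measurable_rectr; exact: sub_measurable_gen_mx.
- exact: (measurable_jac (T := TF) smooth Xx mxF).
Qed.

Lemma true_dirE w : dt w = - (g w *m A w + constr p (x w) *m B w).
Proof.
exact: (kkt_dirE zeta_gt0 (fun sv => jac_singular_value_gt0 smooth (Xx w))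
  (@H_curv w) (kkt_t w)).
Qed.

Lemma dirE w : db w = - (gb w *m A w + constr p (x w) *m B w).
Proof.
exact: (kkt_dirE zeta_gt0 (fun sv => jac_singular_value_gt0 smooth (Xx w))
  (@H_curv w) (kkt_b w)).
Qed.

Lemma dir_noise w : db w - dt w = - (noise w *m A w).
Proof.
rewrite dirE true_dirE /noise mulmxBl; set u := _ *m B w.
by rewrite opprK addrC opprD addrACA subrr addr0 opprB.
Qed.

Lemma db_constr w : db w *m (jac p (x w))^T = - constr p (x w).
Proof.
have := kkt_b w; rewrite /kkt mul_row_block mulmx0 addr0 opp_row_mx.
by case/eq_row_mx.
Qed.

Lemma norm2_noiseA w (u : 'rV[R]_n) : norm2 (u *m A w) <= norm2 u / zeta.
Proof.
exact: (norm2_kktA zeta_gt0 (fun sv => jac_singular_value_gt0 smooth (Xx w))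
  (@H_curv w)).
Qed.

(** The adjoint inherits the operator bound. It is needed because A will be moved from the noise
    onto the vector that the noise is tested against. *)
Lemma norm2_noiseAT w (u : 'rV[R]_n) : norm2 (u *m (A w)^T) <= norm2 u / zeta.
Proof.
set v := u *m _.
have [->|v0] := eqVneq (norm2 v) 0; first by rewrite divr_ge0 ?norm2_ge0// ltW.
have v0' : 0 < norm2 v by rewrite lt0r v0 norm2_ge0.
rewrite -(ler_pM2r v0') -expr2 norm2_sqr {1}/v dotv_mulmx trmxK.
rewrite (le_trans (dotv_le_norm2 _ _))// mulrAC -mulrA.
by rewrite ler_wpM2l ?norm2_ge0// norm2_noiseA.
Qed.


Let D w := delta_l p (x w) tau (g w) (dt w).

Lemma measurable_gradient : measurable_mx g.
Proof.
by move=> i j; rewrite ord1; have [_ ig _ _] := gb_cexp j; exact: (intg_measurable ig).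
Qed.

Lemma history_measurable_dt j : sub_measurable F (fun w => dt w 0 j).
Proof.
have [mA mB] := history_measurable_kkt.
have mxF : @measurable_mx _ TF R _ _ x by move=> i k; rewrite ord1;
  exact: history_measurable_x.
have mgF : @measurable_mx _ TF R _ _ g by move=> i k; rewrite ord1;
  exact: history_measurable_g.
suff : @measurable_mx _ TF R _ _ dt by move=> h; exact: h.
rewrite (_ : dt = fun w => - (g w *m A w + constr p (x w) *m B w)); last first.
  by apply/funext => w; exact: true_dirE.
apply: (@measurable_oppmx _ TF); apply: (@measurable_addmx _ TF).
  exact: (@measurable_mulmx _ TF).
apply: (@measurable_mulmx _ TF) => //.
exact: (measurable_constr (T := TF) smooth Xx mxF).
Qed.

Lemma measurable_true_dir : measurable_mx dt.
Proof. by move=> i j; rewrite ord1;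
  exact: (sub_measurableW sigma_history_measurable (history_measurable_dt j)). Qed.

Lemma L2v_gradient : L2v Q g.
Proof.
have [M hM] := grad_objective_bound smooth.
by apply: (@L2v_bounded _ _ _ _ _ mE QE _ _ M measurable_gradient) => w _; exact: hM.
Qed.

Lemma L2v_noise : L2v Q noise.
Proof.
split.
  by apply: measurable_addmx; [exact: measurable_estimate|apply:
    measurable_oppmx; exact: measurable_gradient].
have [V [iV _ _ _] _] := gb_var.
by apply: intg_eq iV => w; rewrite norm2_sqr.
Qed.

Lemma intg_norm1_constr : intg Q (fun w => norm1 (constr p (x w))).
Proof.
have [M hM] := constr_norm1_bound smooth.
apply: (intg_dom _ (intg_cst Q M)) => [|w /=].
  exact: (measurable_norm1 (measurable_constr smooth Xx mx)).
rewrite ger0_norm; last exact: sumr_ge0.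
by rewrite (le_trans (hM _ (Xx w)))// ler_norm.
Qed.

(** On E the quadratic kl tau |dt|^2 is at most Delta l, which is at most tau G |dt| + C. Young's
    inequality absorbs the linear term, so dt is bounded on E. *)
Lemma L2v_true_dir : L2v Q dt.
Proof.
have [G hG] := grad_objective_bound smooth.
have [C hC] := constr_norm1_bound smooth.
apply: (@L2v_dom _ _ _ _ _ mE QE _ _
  (cst ((kl * tau)^-1 * (2 * C + tau / kl * G ^+ 2))) measurable_true_dir) => [|w Ew].
  exact: intg_cst.
rewrite /cst ler_pdivlMl ?mulr_gt0// -norm2_sqr.
have := dl_t Ew; rewrite /delta_l.
have := hC _ (Xx w); have := hG _ (Xx w); rewrite -/(g w).
have := normr_dotv_le (g w) (dt w); rewrite ler_norml => /andP[h _].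
have := norm2_ge0 (g w); have := norm2_ge0 (dt w).
move: (norm2 (g w)) (norm2 (dt w)) (norm1 _) h => a t c h t0 a0 aG cC dl.
have h1 : kl * tau * t ^+ 2 <= tau * (G * t) + C.
  apply: (le_trans dl); apply: lerD => //;
    rewrite mulNr -mulrN ler_wpM2l ?(ltW tau_gt0)//.
  by rewrite lerNl (le_trans _ h)// lerN2 ler_wpM2r.
have h2 : 2 * (G * t) <= kl * t ^+ 2 + G ^+ 2 / kl.
  have -> : kl * t ^+ 2 + G ^+ 2 / kl = 2 * (G * t) + (kl * t - G) ^+ 2 / kl.
    by field; rewrite gt_eqF.
  by rewrite lerDl divr_ge0 ?sqr_ge0// ltW.
have := ler_wpM2l (ltW tau_gt0) h2.
have -> : tau / kl * G ^+ 2 = tau * (G ^+ 2 / kl) by field; rewrite gt_eqF.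
lra.
Qed.

Lemma norm2_dir_noise w : norm2 (db w - dt w) <= norm2 (noise w) / zeta.
Proof. by rewrite dir_noise norm2N norm2_noiseA. Qed.

Lemma L2v_dir_noise : L2v Q (fun w => db w - dt w).
Proof.
have [mn inn] := L2v_noise.
apply: (@L2v_dom _ _ _ _ _ mE QE _ _ (fun w => zeta ^- 2 * dotv (noise w) (noise w))).
- by apply: measurable_addmx => //; apply: measurable_oppmx; exact: measurable_true_dir.
- exact: intgZ.
- move=> w _; rewrite -!norm2_sqr -exprVn -exprMn.
  rewrite ler_sqr ?nnegrE ?mulr_ge0 ?norm2_ge0 ?invr_ge0 ?(ltW zeta_gt0)//.
  by rewrite mulrC norm2_dir_noise.
Qed.

Lemma L2v_dir : L2v Q db.
Proof.
rewrite (_ : db = fun w => dt w + (db w - dt w)).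
  by apply: (L2vD mE QE); [exact: L2v_true_dir|exact: L2v_dir_noise].
by apply/funext => w; rewrite addrC subrK.
Qed.

Lemma intg_delta : intg Q D.
Proof.
rewrite /D /delta_l; apply: intgD; last exact: intg_norm1_constr.
by apply: intgZ; apply: (L2v_dot mE QE); [exact: L2v_gradient|exact: L2v_true_dir].
Qed.

Lemma noise_centered j : centered Q F (fun w => noise w 0 j).
Proof.
have := cond_indep_centered sigma_iterates_measurable (sigma_mx_measurable mH)
  (sigma_mx_measurable measurable_estimate)
  H_indep (@sub_measurable_gen_mx _ T R _ _ gb 0 j) (gb_cexp j).
by congr (centered Q _ _); apply/funext => w; rewrite !mxE.
Qed.

Lemma Ex_dotv_noise (U : T -> 'rV[R]_n) : L2v Q U ->
  (forall j, sub_measurable F (fun w => U w 0 j)) ->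
  Ex Q (fun w => dotv (U w) (noise w)) = 0.
Proof.
move=> lU mU; apply: (Ex_dotv_centered mE QE sigma_history_measurable mU
  noise_centered lU).
exact: L2v_noise.
Qed.

(** Moving A across the product turns it into - (U A^T) noise, and U A^T is again F-measurable and
    square-integrable. *)
Lemma Ex_dotv_dir_noise (U : T -> 'rV[R]_n) : L2v Q U ->
  (forall j, sub_measurable F (fun w => U w 0 j)) ->
  Ex Q (fun w => dotv (U w) (db w - dt w)) = 0.
Proof.
move=> lU mU; have [mA _] := history_measurable_kkt.
have mUF : @measurable_mx _ TF R _ _ (fun w => - (U w *m (A w)^T)).
  apply: (@measurable_oppmx _ TF); apply: (@measurable_mulmx _ TF).
    by move=> i j; rewrite ord1; exact: mU.
  exact: (@measurable_trmx _ TF).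
have [_ iU] := lU.
rewrite (eq_Ex Q (Y := fun w => dotv (- (U w *m (A w)^T)) (noise w))); last first.
  by move=> w; rewrite dir_noise dotvNl dotvNr dotv_mulmx trmxK.
apply: Ex_dotv_noise => [|j]; last exact: (mUF 0 j).
apply: (@L2v_dom _ _ _ _ _ mE QE _ _ (fun w => zeta ^- 2 * dotv (U w) (U w))).
- by move=> i j; exact: (sub_measurableW sigma_history_measurable (mUF i j)).
- exact: intgZ.
- move=> w _; rewrite -!norm2_sqr -exprVn -exprMn.
  rewrite ler_sqr ?nnegrE ?mulr_ge0 ?norm2_ge0 ?invr_ge0 ?(ltW zeta_gt0)//.
  by rewrite mulrC norm2N norm2_noiseAT.
Qed.

Lemma Ex_noise_le : Ex Q (fun w => dotv (noise w) (noise w)) <=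
  L ^+ 2 / b%:R * Ex Q (fun w => dotv (x w - x0 w) (x w - x0 w)).
Proof.
have [V [iN iV _ EV] [N1 [mN QN sN]]] := gb_var.
have [_ id] := L2_dist.
have -> : Ex Q (fun w => dotv (noise w) (noise w)) = Ex Q V.
  have := EV setT (@measurableT _ (g_sigma_algebraType R0)).
  rewrite (ExE iN) (ExE iV) => -[<-].
  by apply: eq_Ex => w; rewrite norm2_sqr.
rewrite -ExZ//.
(* The variance bound holds almost surely, so the complement of its exceptional set takes the part
   that E has elsewhere. *)
have QNC : Q (~` ~` N1) = 0%E by rewrite setCK.
apply: (le_Ex_on (measurableC mN) QNC iV (intgZ _ id)) => w /= Nw.
apply/negPn/negP => h; apply: Nw; apply: sN => /=; apply/negP.
by rewrite norm2_sqr.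
Qed.

Let xn w := x w + alpha *: db w.

Lemma measurable_next : measurable_mx xn.
Proof.
apply: measurable_addmx => // i j.
rewrite (_ : (fun w => _) = (fun w => alpha * db w i j)).
  by apply: measurable_funM => //; exact: mdb.
by apply/funext => w; rewrite mxE.
Qed.

Lemma intg_merit_bounded (y : T -> 'rV[R]_n) : (forall w, X (y w)) ->
  measurable_mx y -> intg Q (fun w => merit p (y w) tau).
Proof.
move=> Xy my; have [M hM] := merit_bound smooth (ltW tau_gt0).
apply: (intg_dom _ (intg_cst Q M)) => [|w /=].
  exact: (measurable_merit smooth Xy my).
by rewrite (le_trans (hM _ (Xy w)))// ler_norm.
Qed.

Lemma L2v_dist_next : L2v Q (fun w => xn w - x0 w).
Proof.
rewrite (_ : (fun w => _) = fun w => (x w - x0 w) + alpha *: db w).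
  by apply: (L2vD mE QE) => //; apply: L2vZ; exact: L2v_dir.
by apply/funext => w; rewrite /xn addrAC.
Qed.

Lemma Ex_dt_le : kl * tau * Ex Q (fun w => dotv (dt w) (dt w)) <= Ex Q D.
Proof.
have [_ idt] := L2v_true_dir; rewrite -ExZ//.
apply: (le_Ex_on mE QE (intgZ _ idt) intg_delta) => w /dl_t.
by rewrite norm2_sqr.
Qed.

(** With e = db - dt, Delta l at (gb, db) is D - tau (g e + noise dt + noise e). The first two
    products have mean zero and the third is at most |noise|^2 / zeta in absolute value. *)
Lemma Ex_db_le : kl * tau * Ex Q (fun w => dotv (db w) (db w)) <=
  Ex Q D + tau / zeta * Ex Q (fun w => dotv (noise w) (noise w)).
Proof.
have [_ idb] := L2v_dir; have [_ inoise] := L2v_noise.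
have idtn : intg Q (fun w => dotv (dt w) (noise w)).
  by apply: (L2v_dot mE QE); [exact: L2v_true_dir|exact: L2v_noise].
have ige : intg Q (fun w => dotv (g w) (db w - dt w)).
  by apply: (L2v_dot mE QE); [exact: L2v_gradient|exact: L2v_dir_noise].
have i1 := intgD intg_delta (intgZ (tau / zeta) inoise).
have i2 := intgD (intgZ tau idtn) (intgZ tau ige).
have Z1 := Ex_dotv_noise L2v_true_dir history_measurable_dt.
have Z2 := Ex_dotv_dir_noise L2v_gradient history_measurable_g.
have -> : Ex Q D + tau / zeta * Ex Q (fun w => dotv (noise w) (noise w)) =
    Ex Q (fun w => (D w + tau / zeta * dotv (noise w) (noise w)) -
      (tau * dotv (dt w) (noise w) + tau * dotv (g w) (db w - dt w))).
  rewrite (ExB i1 i2) (ExD intg_delta (intgZ _ inoise)) (ExD (intgZ _ idtn)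
    (intgZ _ ige)).
  by rewrite !ExZ// Z1 Z2 !mulr0 addr0 subr0.
rewrite -ExZ//.
apply: (le_Ex_on mE QE (intgZ _ idb) (intgB i1 i2)) => w Ew.
rewrite -norm2_sqr (le_trans (dl_b Ew))// /D /delta_l.
have h : - dotv (noise w) (db w - dt w) <= dotv (noise w) (noise w) / zeta.
  rewrite -dotvNr (le_trans (dotv_le_norm2 _ _))// norm2N -norm2_sqr expr2 -mulrA.
  by rewrite ler_wpM2l ?norm2_ge0// norm2_dir_noise.
have := ler_wpM2l (ltW tau_gt0) h.
have -> : gb w = g w + noise w by rewrite /noise addrC subrK.
move: (noise w) => nw.
rewrite !(dotvDl, dotvDr, dotvNl, dotvNr) (dotvC (dt w) nw).
rewrite (_ : tau / zeta * dotv nw nw = tau * (dotv nw nw / zeta)); last by ring.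
lra.
Qed.

(** The vector u = x - x0 is F-measurable, so in expectation the cross term 2 alpha u db equals 2
    alpha u dt, which Young's inequality with weight z splits. *)
Lemma Ex_dist_le (z : R) : 0 < z ->
  Ex Q (fun w => dotv (xn w - x0 w) (xn w - x0 w)) <=
  (1 + alpha * z) * Ex Q (fun w => dotv (x w - x0 w) (x w - x0 w))
  + alpha / z * Ex Q (fun w => dotv (dt w) (dt w))
  + alpha ^+ 2 * Ex Q (fun w => dotv (db w) (db w)).
Proof.
move=> z0; have [_ idist] := L2_dist; have [_ idt] := L2v_true_dir;
  have [_ idb] := L2v_dir.
have [_ idist'] := L2v_dist_next.
have ie : intg Q (fun w => dotv (x w - x0 w) (db w - dt w)).
  by apply: (L2v_dot mE QE) => //; exact: L2v_dir_noise.
have Z : Ex Q (fun w => dotv (x w - x0 w) (db w - dt w)) = 0.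
  apply: Ex_dotv_dir_noise => // j.
  rewrite (_ : (fun w => _) = (fun w => x w 0 j - x0 w 0 j)).
    by apply: (@measurable_funB _ TF);
      [exact: history_measurable_x|exact: history_measurable_x0].
  by apply/funext => w; rewrite !mxE.
have i1 := intgD (intgZ (1 + alpha * z) idist) (intgZ (alpha / z) idt).
have i2 := intgD i1 (intgZ (alpha ^+ 2) idb).
have i3 := intgD i2 (intgZ (2 * alpha) ie).
have -> : (1 + alpha * z) * Ex Q (fun w => dotv (x w - x0 w) (x w - x0 w))
  + alpha / z * Ex Q (fun w => dotv (dt w) (dt w))
  + alpha ^+ 2 * Ex Q (fun w => dotv (db w) (db w)) =
  Ex Q (fun w => (1 + alpha * z) * dotv (x w - x0 w) (x w - x0 w)
    + alpha / z * dotv (dt w) (dt w) + alpha ^+ 2 * dotv (db w) (db w)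
    + (2 * alpha) * dotv (x w - x0 w) (db w - dt w)).
  rewrite (ExD i2 (intgZ _ ie)) (ExD i1 (intgZ _ idb)).
  rewrite (ExD (intgZ _ idist) (intgZ _ idt)) !ExZ//.
  by rewrite Z mulr0 addr0.
apply: le_Ex => // w.
have a0 : 0 < alpha by case/andP: alpha01.
have -> : xn w - x0 w = (x w - x0 w) + alpha *: db w by rewrite /xn addrAC.
move: (x w - x0 w) (db w) (dt w) => u v t.
have -> : dotv (u + alpha *: v) (u + alpha *: v) =
    dotv u u + 2 * alpha * dotv u v + alpha ^+ 2 * dotv v v.
  by rewrite !(dotvDl, dotvDr, dotvZl, dotvZr) (dotvC v u); ring.
have := dotv_ge0 (z *: u - t).
rewrite !(dotvDl, dotvDr, dotvNl, dotvNr, dotvZl, dotvZr) (dotvC t u) => h.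
have h1 : 2 * dotv u t <= z * dotv u u + dotv t t / z.
  rewrite -(ler_pM2l z0) mulrDr [z * (dotv t t / z)]mulrCA divff ?gt_eqF// mulr1.
  lra.
have := ler_wpM2l (ltW a0) h1.
rewrite (_ : alpha / z * dotv t t = alpha * (dotv t t / z)); last by ring.
lra.
Qed.

(** The descent lemma produces Delta l at the true gradient and the computed direction. It differs
    from D by - tau g (db - dt), which has mean zero. *)
Lemma Ex_merit_le (rho : R) : rho = tau * L + \sum_(i < m) gam i ->
  Ex Q (fun w => merit p (xn w) tau) <=
  Ex Q (fun w => merit p (x w) tau) - alpha * Ex Q D
  + rho / 2 * alpha ^+ 2 * Ex Q (fun w => dotv (db w) (db w)).
Proof.
move=> rhoE; have [_ idb] := L2v_dir.
have /andP[a0 a1] := alpha01.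
have ige : intg Q (fun w => dotv (g w) (db w - dt w)).
  by apply: (L2v_dot mE QE); [exact: L2v_gradient|exact: L2v_dir_noise].
have Z := Ex_dotv_dir_noise L2v_gradient history_measurable_g.
have im := intg_merit_bounded Xx mx.
have i1 := intgB im (intgZ alpha intg_delta).
have i2 := intgD i1 (intgZ (rho / 2 * alpha ^+ 2) idb).
have i3 := intgD i2 (intgZ (alpha * tau) ige).
have -> : Ex Q (fun w => merit p (x w) tau) - alpha * Ex Q D
  + rho / 2 * alpha ^+ 2 * Ex Q (fun w => dotv (db w) (db w)) =
  Ex Q (fun w => merit p (x w) tau - alpha * D w
    + rho / 2 * alpha ^+ 2 * dotv (db w) (db w)
    + alpha * tau * dotv (g w) (db w - dt w)).
  rewrite (ExD i2 (intgZ _ ige)) (ExD i1 (intgZ _ idb)).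
  rewrite (ExB im (intgZ _ intg_delta)) !ExZ//; last exact: intg_delta.
  by rewrite Z mulr0 addr0.
apply: le_Ex => // [|w]; first exact: (intg_merit_bounded Xn measurable_next).
have := merit_descent smooth N_gt0 (Xx w) (Xn w) _ (ltW tau_gt0) (db_constr w).
rewrite (ltW a0) a1 => /(_ isT); rewrite -rhoE norm2_sqr => /le_trans; apply.
rewrite /D /delta_l -/(g w) dotvBr; lra.
Qed.

Lemma Ex_lyapunov_le (rho lam' z : R) : 0 <= rho ->
  rho = tau * L + \sum_(i < m) gam i -> 0 <= lam' -> 0 < z ->
  Ex Q (fun w => merit p (xn w) tau)
    + lam' * Ex Q (fun w => dotv (xn w - x0 w) (xn w - x0 w)) <=
  Ex Q (fun w => merit p (x w) tau)
    + (lam' * (alpha ^+ 2 * L ^+ 2 / (kl * b%:R * zeta) + alpha * z + 1)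
       + alpha ^+ 2 * rho * L ^+ 2 / (2 * kl * b%:R * zeta))
      * Ex Q (fun w => dotv (x w - x0 w) (x w - x0 w))
    - (alpha - alpha ^+ 2 * rho / (2 * tau * kl)
       - lam' * (alpha / (tau * kl)) * (alpha + z^-1)) * Ex Q D.
Proof.
move=> rho0 rhoE lam0 z0.
have hm := Ex_merit_le rhoE; have hd := Ex_dist_le z0.
have hb := Ex_db_le; have ht := Ex_dt_le; have hn := Ex_noise_le.
have /andP[a0 _] := alpha01.
(* From here on the expectations are abstract reals, linked only by the five inequalities just
   introduced. *)
move: (Ex Q (fun w => merit p (xn w) tau)) (Ex Q (fun w => merit p (x w) tau)) hm
  => phi' phi hm.
move: (Ex Q (fun w => dotv (xn w - x0 w) (xn w - x0 w))) hd => V' hd.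
move: (Ex Q (fun w => dotv (x w - x0 w) (x w - x0 w))) hd hn => V hd hn.
move: (Ex Q (fun w => dotv (db w) (db w))) hm hd hb => Fb hm hd hb.
move: (Ex Q (fun w => dotv (dt w) (dt w))) hd ht => Ft hd ht.
move: (Ex Q (fun w => dotv (noise w) (noise w))) hb hn => Nn hb hn.
move: (Ex Q D) hm hb ht => DD hm hb ht.
have kt0 : 0 < kl * tau by rewrite mulr_gt0.
have b0 : (0 : R) < b%:R by rewrite ltr0n.
have Fb_le : Fb <= DD / (kl * tau) + L ^+ 2 / (kl * b%:R * zeta) * V.
  rewrite -(ler_pM2l kt0) (le_trans hb)//.
  have -> : kl * tau * (DD / (kl * tau) + L ^+ 2 / (kl * b%:R * zeta) * V) =
     DD + tau / zeta * (L ^+ 2 / b%:R * V) by field; rewrite !gt_eqF.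
  by rewrite lerD2l ler_wpM2l// divr_ge0// ltW.
have Ft_le : Ft <= DD / (kl * tau) by rewrite ler_pdivlMr// mulrC.
have c1 : 0 <= rho / 2 * alpha ^+ 2.
  by apply: mulr_ge0; rewrite ?sqr_ge0 ?divr_ge0.
have h1 := ler_wpM2l c1 Fb_le.
have h2 := ler_wpM2l (sqr_ge0 alpha) Fb_le.
have h3 := ler_wpM2l (ltW (divr_gt0 a0 z0)) Ft_le.
have h4 : V' <= (1 + alpha * z) * V + alpha / z * (DD / (kl * tau)) +
   alpha ^+ 2 * (DD / (kl * tau) + L ^+ 2 / (kl * b%:R * zeta) * V) by lra.
have h5 := ler_wpM2l lam0 h4.
(* Collecting the coefficients of V and of DD is what produces the recursion for lambda and the
   formula for Lambda. *)
have -> : phi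
    + (lam' * (alpha ^+ 2 * L ^+ 2 / (kl * b%:R * zeta) + alpha * z + 1)
       + alpha ^+ 2 * rho * L ^+ 2 / (2 * kl * b%:R * zeta)) * V
    - (alpha - alpha ^+ 2 * rho / (2 * tau * kl)
       - lam' * (alpha / (tau * kl)) * (alpha + z^-1)) * DD =
  phi - alpha * DD
  + rho / 2 * alpha ^+ 2 * (DD / (kl * tau) + L ^+ 2 / (kl * b%:R * zeta) * V)
  + lam' * ((1 + alpha * z) * V + alpha / z * (DD / (kl * tau)) +
   alpha ^+ 2 * (DD / (kl * tau) + L ^+ 2 / (kl * b%:R * zeta) * V)).
  by field; rewrite !gt_eqF.
lra.
Qed.

Lemma Ex_delta_ge0 : 0 <= Ex Q D.
Proof.
apply: le_trans Ex_dt_le; apply: mulr_ge0; first by rewrite mulr_ge0 ?ltW.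
by rewrite -(Ex_cst Q 0); apply: le_Ex => [||w];
  [exact: intg_cst|case: L2v_true_dir|exact: dotv_ge0].
Qed.

(** Gathers what the analysis of the whole run needs, so that the long list of hypotheses of this
    section is instantiated once. *)
Lemma step_summary :
  [/\ L2v Q (fun w => xn w - x0 w), intg Q D,
      intg Q (fun w => merit p (x w) tau), 0 <= Ex Q D &
  forall rho lam' z : R, 0 <= rho ->
  rho = tau * L + \sum_(i < m) gam i -> 0 <= lam' -> 0 < z ->
  Ex Q (fun w => merit p (xn w) tau)
    + lam' * Ex Q (fun w => dotv (xn w - x0 w) (xn w - x0 w)) <=
  Ex Q (fun w => merit p (x w) tau)
    + (lam' * (alpha ^+ 2 * L ^+ 2 / (kl * b%:R * zeta) + alpha * z + 1)
       + alpha ^+ 2 * rho * L ^+ 2 / (2 * kl * b%:R * zeta))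
      * Ex Q (fun w => dotv (x w - x0 w) (x w - x0 w))
    - (alpha - alpha ^+ 2 * rho / (2 * tau * kl)
       - lam' * (alpha / (tau * kl)) * (alpha + z^-1)) * Ex Q D].
Proof.
split; [exact: L2v_dist_next|exact: intg_delta|exact: intg_merit_bounded Xx mx|
  exact: Ex_delta_ge0|exact: Ex_lyapunov_le].
Qed.

End Step.

(** * Telescoping over the run *)

Section Run.
Context {R : realType} {n m N : nat} (p : problem R n m N).
Context (X : set 'rV[R]_n) (L : R) (gam : 'I_m -> R).
Context {d : measure_display} {T : measurableType d} (P : probability T R).
Context (r : run R T n m N) (x_in : 'rV[R]_n).
Variables (tau_in eps_tau sigma kappa_H alpha zeta kl tau : R) (b S ktau : nat).
Hypotheses (smooth : smoothness p X L gam) (N_gt0 : (0 < N)%N).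
Hypotheses (b_gt0 : (0 < b)%N).
Hypotheses (zeta_gt0 : 0 < zeta) (kl_gt0 : 0 < kl) (tau_gt0 : 0 < tau).
Hypothesis alpha01 : 0 < alpha <= 1.
Hypothesis algo : vr_sqp p r x_in tau_in eps_tau sigma alpha b S.
Hypothesis meas : measurable_run r S.
Hypothesis Xit : forall k s w, (s <= S)%N -> X (xit r k s w).
Hypothesis mats : matrices p r S kappa_H zeta.
Hypothesis mE : measurable (merit_event p r sigma S ktau tau).
Let E := merit_event p r sigma S ktau tau.
Let Q := cond_prob P mE.
Hypothesis PE : (0 < P E)%E.
Hypothesis ge : gradient_estimates p r Q L b S.
Hypothesis Hind : H_independent p r Q b S.
Hypothesis dlb : delta_l_bounds p r E b S kl.

Let rho := tau * L + \sum_(i < m) gam i.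
Let D k s w := delta_l p (xit r k s w) tau (gtrue p r k s w) (dtrue r k s w).
Let phi k s w := merit p (xit r k s w) tau.
Let V k s w := dotv (xit r k s w - xit r k 0 w) (xit r k s w - xit r k 0 w).

Lemma x_next k s w : (s < S)%N ->
  xit r k s.+1 w = xit r k s w + alpha *: dbar r k s w.
Proof.
move=> sS; rewrite (x_inner algo)//; case: eqP => // ->.
by rewrite scaler0 addr0.
Qed.

Lemma event_null : Q (~` E) = 0%E.
Proof. exact: cond_prob_setC. Qed.

Lemma curvature k s w (sS : (s < S)%N) (u : 'rV[R]_n) :
  u *m (jac p (xit r k s w))^T = 0 ->
  zeta * norm2 u ^+ 2 <= dotv (u *m Hmat r k s w) u.
Proof. exact: (H_curvature mats). Qed.

Lemma Xnext k s w : (s < S)%N -> X (xit r k s w + alpha *: dbar r k s w).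
Proof. by move=> sS; rewrite -x_next//; exact: Xit. Qed.

Lemma dl_true k s w : (ktau <= k)%N -> (s < S)%N -> E w ->
  kl * tau * norm2 (dtrue r k s w) ^+ 2 <= D k s w.
Proof.
move=> hk sS Ew; have := delta_l_true dlb k Ew sS.
by have [-> _] := Ew k s hk sS.
Qed.

Lemma dl_bar k s w : (ktau <= k)%N -> (s < S)%N -> E w ->
  kl * tau * norm2 (dbar r k s w) ^+ 2 <=
  delta_l p (xit r k s w) tau (gbar p r b k s w) (dbar r k s w).
Proof.
move=> hk sS Ew; have := delta_l_bar dlb k Ew sS.
by have [-> _] := Ew k s hk sS.
Qed.

Lemma run_step k s : (ktau <= k)%N -> (s < S)%N ->
  L2v Q (fun w => xit r k s w - xit r k 0 w) ->
  [/\ L2v Q (fun w => xit r k s.+1 w - xit r k 0 w), intg Q (D k s),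
      intg Q (phi k s), 0 <= Ex Q (D k s) &
  forall lam' z : R, 0 <= rho -> 0 <= lam' -> 0 < z ->
  Ex Q (phi k s.+1) + lam' * Ex Q (V k s.+1) <= Ex Q (phi k s)
    + (lam' * (alpha ^+ 2 * L ^+ 2 / (kl * b%:R * zeta) + alpha * z + 1)
       + alpha ^+ 2 * rho * L ^+ 2 / (2 * kl * b%:R * zeta)) * Ex Q (V k s)
    - (alpha - alpha ^+ 2 * rho / (2 * tau * kl)
       - lam' * (alpha / (tau * kl)) * (alpha + z^-1)) * Ex Q (D k s)].
Proof.
move=> hk sS l2.
have xE : xit r k s.+1 = (fun w => xit r k s w + alpha *: dbar r k s w).
  by apply/funext => w; exact: x_next.
rewrite /phi /V xE.
have [h1 h2 h3 h4 h5] := @step_summary _ _ _ _ p X L gam _ _ Q E b zeta kl tau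
  alpha (xit r k 0)
  (xit r k s) (gbar p r b k s) (dbar r k s) (dtrue r k s) (ybar r k s) (ytrue r k s)
  (Hmat r k s) smooth N_gt0 b_gt0 zeta_gt0 kl_gt0 tau_gt0 alpha01 mE event_null
  (fun w => Xit k w (ltnW sS)) (fun w => Xnext k w sS)
  (m_x meas k (leq0n S)) (m_x meas k (ltnW sS)) (m_H meas k sS) (m_dbar meas k sS)
  (fun w => @curvature k s w sS)
  (fun w => bar_kkt algo k w sS) (fun w => true_kkt algo k w sS)
  (fun w => @dl_true k s w hk sS) (fun w => @dl_bar k s w hk sS)
  (fun i => gbar_unbiased ge k i sS) (gbar_variance ge k sS) (@Hind k s sS) l2.
split => // lam' z rho0; exact: h5.
Qed.

(** [run_step] takes square integrability at s and returns it at s + 1; the induction starts from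
    the zero vector at s = 0. *)
Lemma L2v_run k s : (ktau <= k)%N -> (s <= S)%N ->
  L2v Q (fun w => xit r k s w - xit r k 0 w).
Proof.
move=> hk; elim: s => [_|s IH sS]; last by have [] := run_step hk sS (IH (ltnW sS)).
apply: (@L2v_bounded _ _ _ _ _ mE event_null _ _ 0) => [i j|w _].
  rewrite (_ : (fun w => _) = cst 0); first exact: measurable_cst.
  by apply/funext => w; rewrite subrr mxE.
by rewrite subrr /norm2 dotv0l sqrtr0.
Qed.

Lemma intg_run_delta k s : (ktau <= k)%N -> (s < S)%N -> intg Q (D k s).
Proof. by move=> hk sS; have [] := run_step hk sS (L2v_run hk (ltnW sS)). Qed.

Lemma intg_run_merit k s : (ktau <= k)%N -> (s < S)%N -> intg Q (phi k s).
Proof. by move=> hk sS; have [] := run_step hk sS (L2v_run hk (ltnW sS)). Qed.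

Variables (lambda : nat -> R) (z c : R).
Hypotheses (rho_ge0 : 0 <= rho) (z_gt0 : 0 < z).
Hypothesis lambda_ge0 : forall s, (s <= S)%N -> 0 <= lambda s.
Hypothesis lambda_S : lambda S = 0.
Hypothesis lambda_rec : forall s, (s < S)%N ->
  lambda s = lambda s.+1 * (alpha ^+ 2 * L ^+ 2 / (kl * b%:R * zeta) + alpha * z + 1)
    + alpha ^+ 2 * rho * L ^+ 2 / (2 * kl * b%:R * zeta).
Hypothesis Lambda_ge : forall s, (s < S)%N ->
  c <= alpha - alpha ^+ 2 * rho / (2 * tau * kl)
         - lambda s.+1 * (alpha / (tau * kl)) * (alpha + z^-1).

Lemma inner_descent k s : (ktau <= k)%N -> (s <= S)%N ->
  Ex Q (phi k s) + lambda s * Ex Q (V k s)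
    + c * \sum_(i < s) Ex Q (D k i) <= Ex Q (phi k 0).
Proof.
move=> hk; elim: s => [_|s IH sS].
  rewrite big_ord0 mulr0 addr0 (_ : V k 0 = cst 0) ?Ex_cst ?mulr0 ?addr0//.
  by apply/funext => w; rewrite /V subrr dotv0l.
apply: le_trans (IH (ltnW sS)).
have [_ _ _ D0 step] := run_step hk sS (L2v_run hk (ltnW sS)).
have := step _ _ rho_ge0 (lambda_ge0 sS) z_gt0; rewrite -lambda_rec// => h.
(* Replacing Lambda_s by its lower bound c uses that Delta l has nonnegative expectation. *)
have := ler_wpM2r D0 (Lambda_ge sS); rewrite big_ord_recr /=; lra.
Qed.

Lemma outer_descent k : (ktau <= k)%N ->
  Ex Q (phi k.+1 0) + c * \sum_(i < S) Ex Q (D k i) <= Ex Q (phi k 0).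
Proof.
move=> hk; have := inner_descent hk (leqnn S).
rewrite lambda_S mul0r addr0 (_ : phi k S = phi k.+1 0)//.
by apply/funext => w; rewrite /phi (x_outer algo).
Qed.

Lemma total_descent l :
  Ex Q (phi (l + ktau) 0) + c * \sum_(j < l) \sum_(i < S) Ex Q (D (j + ktau) i)
  <= Ex Q (phi ktau 0).
Proof.
elim: l => [|l IH]; first by rewrite big_ord0 mulr0 addr0 add0n.
apply: le_trans IH; have := outer_descent (leq_addl l ktau).
rewrite big_ord_recr /= addSn; lra.
Qed.

End Run.

Theorem theorem4p12 (R : realType) (n m : nat) (gam : 'I_m -> R)
    (L zeta kappa_l tau_min : R)
    (gam_gt0 : forall i, 0 < gam i) (L_ge0 : 0 <= L) (zeta_gt0 : 0 < zeta)
    (kappa_l_gt0 : 0 < kappa_l) (tau_min_gt0 : 0 < tau_min) :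
  let rho := tau_min * L + \sum_(i < m) gam i in
  exists mu0 nu0 : R, [/\ 0 < mu0 <= 1, 0 < nu0 < 1 &
  forall (N b S : nat) (gamma : R),
    (0 < b < N)%N -> (0 < S)%N ->
    0 < gamma <= 1 -> b%:R < N%:R `^ gamma ->
  forall (p : problem R n m N) (X : set 'rV[R]_n)
    (d : measure_display) (T : measurableType d) (P : probability T R)
    (r : run R T n m N)
    (x_in : 'rV[R]_n) (tau_in eps_tau sigma kappa_H alpha z : R) (ktau : nat),
    smoothness p X L gam ->
    0 < tau_in -> 0 < eps_tau < 1 -> 0 < sigma < 1 -> 0 < kappa_H ->
    vr_sqp p r x_in tau_in eps_tau sigma alpha b S ->
    measurable_run r S ->
    (forall k s w, (s <= S)%N -> X (xit r k s w)) ->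
    matrices p r S kappa_H zeta ->
    has_lbound [set merit p x tau_min | x in X] ->
  forall (mE : measurable (merit_event p r sigma S ktau tau_min)),
    let E := merit_event p r sigma S ktau tau_min in
    let Q := cond_prob P mE in
    (0 < P E)%E ->
    gradient_estimates p r Q L b S ->
    H_independent p r Q b S ->
    delta_l_bounds p r E b S kappa_l ->
    alpha = mu0 * b%:R / (rho * N%:R `^ gamma) -> 0 < alpha <= 1 ->
    z = rho / N%:R `^ (gamma / 2) ->
    S%:Z <= Num.floor (N%:R `^ (3 * gamma / 2) /
             (mu0 * (b%:R + L ^+ 2 / (rho ^+ 2 * kappa_l * zeta)))) ->
  forall lambda : nat -> R,
    lambda S = 0 ->
    (forall s, (s < S)%N ->
       lambda s =
         lambda s.+1 * (alpha ^+ 2 * L ^+ 2 / (kappa_l * b%:R * zeta)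
                        + alpha * z + 1)
         + alpha ^+ 2 * rho * L ^+ 2 / (2 * kappa_l * b%:R * zeta)) ->
    let Lambda s :=
      alpha - alpha ^+ 2 * rho / (2 * tau_min * kappa_l)
      - lambda s.+1 * (alpha / (tau_min * kappa_l)) * (alpha + z^-1) in
    let Lambda_min := \big[Num.min/Lambda 0%N]_(s < S) Lambda s in
    let phi_inf := inf [set merit p x tau_min | x in X] in
    nu0 * b%:R / (rho * N%:R `^ gamma) <= Lambda_min /\
    forall k, (ktau <= k)%N ->
      ('E_Q[fun w => (((k - ktau).+1 * S)%:R^-1 *
          \sum_(ktau <= j < k.+1) \sum_(s < S)
            delta_l p (xit r j s w) tau_min (gtrue p r j s w) (dtrue r j s w))%R]
       <= (rho * N%:R `^ gamma / (((k - ktau).+1 * S)%:R * nu0 * b%:R))%R%:E *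
          ('E_Q[fun w => merit p (xit r ktau 0 w) tau_min] - phi_inf%:E))%E].
Proof.
move=> rho.
pose D := L ^+ 2 / (rho ^+ 2 * kappa_l * zeta).
pose M := (2^-1 + expR 2 * D) / (tau_min * kappa_l).
have rho_ge0 : 0 <= rho.
  by rewrite addr_ge0 ?mulr_ge0 ?(ltW tau_min_gt0)// sumr_ge0// => i _; exact: ltW.
have D0 : 0 <= D by rewrite /D divr_ge0 ?sqr_ge0// !mulr_ge0 ?sqr_ge0// ltW.
have M0 : 0 <= M.
  apply: divr_ge0; last by rewrite mulr_ge0 ?ltW.
  by rewrite addr_ge0 ?invr_ge0// mulr_ge0// expR_ge0.
have den0 : 0 < 1 + D + 2 * M by lra.
(* The summands 1, D and 2 M yield in turn mu0 <= 1, mu0 D <= 1 and mu0 M <= 1/2. The second serves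
   S theta <= 2, the third leaves half of alpha in Lambda. *)
pose mu0 := (1 + D + 2 * M)^-1.
have mu00 : 0 < mu0 by rewrite invr_gt0.
have muE : mu0 * (1 + D + 2 * M) = 1 by rewrite mulVf ?gt_eqF.
have muD0 := mulr_ge0 (ltW mu00) D0; have muM0 := mulr_ge0 (ltW mu00) M0.
have mu01 : mu0 <= 1 by lra.
have muD : mu0 * D <= 1 by lra.
have muM : mu0 * (2^-1 + expR 2 * D) / (tau_min * kappa_l) <= 2^-1.
  by rewrite -mulrA -/M; lra.
exists mu0, (mu0 / 2); split; [by rewrite mu00|apply/andP; split; lra|].
move=> N b S gamma /andP[b0 bN] S0 /andP[g0 g1] bNg p X d T P r x_in tau_in eps_tau
  sigma kappa_H alpha z ktau smooth _ _ _ _ algo meas Xit mats lbX mE E Q PE ge Hind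
  dlb alphaE alpha01 zE SE lambda lambda_S lambda_rec Lambda Lambda_min phi_inf.
have N0 : (0 < N)%N by exact: leq_ltn_trans bN.
have NR1 : 1 <= N%:R :> R by rewrite ler1n.
have NR0 : N%:R != 0 :> R by rewrite pnatr_eq0 -lt0n.
pose q := (N%:R : R) `^ (gamma / 2).
have q1 : 1 <= q.
  by rewrite -[leLHS](powRr0 N%:R) ler_powR// divr_ge0// ltW.
have q0 : 0 < q by rewrite (lt_le_trans _ q1).
have q2 : N%:R `^ gamma = q ^+ 2.
  by rewrite expr2 -powRD; [congr powR; lra|apply/implyP].
have q3 : N%:R `^ (3 * gamma / 2) = q ^+ 3.
  rewrite exprS expr2 -!powRD; try exact/implyP.
  by congr powR; lra.
rewrite q2 in bNg alphaE *; rewrite q3 in SE.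
have /andP[a0 _] := alpha01.
have rho0 : 0 < rho.
  (* For L = 0 and m = 0 the constant rho vanishes; alpha would then be 0 by the convention 0^-1 =
     0, against alpha > 0. *)
  rewrite lt0r rho_ge0 andbT; apply/eqP => rho00.
  by move: a0; rewrite alphaE rho00 mul0r invr0 mulr0 ltxx.
have bR1 : 1 <= b%:R :> R by rewrite ler1n.
have z0 : 0 < z by rewrite zE divr_gt0.
have SR : S%:R <= q ^+ 3 / (mu0 * (b%:R + D)) by move: SE; rewrite floor_ge_int.
have theta0 : 0 <= alpha ^+ 2 * L ^+ 2 / (kappa_l * b%:R * zeta) + alpha * z.
  apply: addr_ge0; last by rewrite mulr_ge0 ?ltW.
  by rewrite divr_ge0 ?mulr_ge0 ?sqr_ge0// ltW.
have C0 : 0 <= alpha ^+ 2 * rho * L ^+ 2 / (2 * kappa_l * b%:R * zeta).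
  by rewrite divr_ge0 ?mulr_ge0 ?sqr_ge0// ltW.
have lam := backward_recursion_bound theta0 C0 lambda_S lambda_rec.
have lam0 s : (s <= S)%N -> 0 <= lambda s by move=> /lam/andP[].
have Lge s : (s < S)%N -> mu0 / 2 * b%:R / (rho * q ^+ 2) <= Lambda s.
  move=> sS; apply: (@Lambda_ge_half _ rho zeta kappa_l tau_min L mu0 q b%:R
    S%:R) => //.
  - by rewrite mu00.
  - exact: (lam s.+1 sS).
split.
  (* The default [Lambda 0] of the minimum is one of its values because 0 < S. *)
  rewrite /Lambda_min; elim/big_ind : _ => [|x y hx hy|i _]; first exact: Lge.
    by rewrite le_min hx hy.
  exact: Lge.
move=> k hk.
set c := mu0 / 2 * b%:R / (rho * q ^+ 2) in Lge.
have c0 : 0 < c by rewrite divr_gt0 ?mulr_gt0 ?exprn_gt0 ?ltr0n// divr_gt0.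
pose Dl j s w := delta_l p (xit r j s w) tau_min (gtrue p r j s w) (dtrue r j s w).
pose phi j s w := merit p (xit r j s w) tau_min.
pose l := (k - ktau).+1.
have tot : Ex Q (phi (l + ktau)%N 0%N) +
    c * \sum_(j < l) \sum_(i < S) Ex Q (Dl (j + ktau)%N i) <= Ex Q (phi ktau 0%N).
  exact: (total_descent smooth N0 b0 zeta_gt0 kappa_l_gt0 tau_min_gt0 alpha01 algo meas
    Xit mats PE ge Hind dlb rho_ge0 z0 lam0 lambda_S lambda_rec Lge).
have iphi j : (ktau <= j)%N -> intg Q (phi j 0%N).
  by move=> hj; exact: (intg_run_merit smooth N0 b0 zeta_gt0 kappa_l_gt0
    tau_min_gt0 alpha01 algo meas
    Xit mats PE ge Hind dlb hj S0).
have iD j s : (ktau <= j)%N -> (s < S)%N -> intg Q (Dl j s).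
  by move=> hj sS; exact: (intg_run_delta smooth N0 b0 zeta_gt0 kappa_l_gt0
    tau_min_gt0 alpha01 algo meas
    Xit mats PE ge Hind dlb hj sS).
(* Here l + ktau = k + 1: the telescoped sum ends at x_{k+1,0}, which lies in X, so its merit value
   is at least phi_inf. *)
have inf_le : phi_inf <= Ex Q (phi (l + ktau)%N 0%N).
  rewrite -(Ex_cst Q phi_inf); apply: le_Ex; [exact: intg_cst|exact/iphi/leq_addl|].
  by move=> w; apply: ge_inf => //; exists (xit r (l + ktau)%N 0%N w) => //; exact: Xit.
pose f w := ((l * S)%:R^-1 * \sum_(j < l) \sum_(s < S) Dl (j + ktau)%N s w).
have isum (j : 'I_l) : intg Q (fun w => \sum_(s < S) Dl (j + ktau)%N s w).
  by apply: intg_sum => s _; exact: iD (leq_addl _ _) (ltn_ord s).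
have -> : (fun w => (l * S)%:R^-1 * \sum_(ktau <= j < k.+1) \sum_(s < S)
    delta_l p (xit r j s w) tau_min (gtrue p r j s w) (dtrue r j s w)) = f.
  apply/funext => w; rewrite /f -{1}[ktau]add0n big_addn subSn// big_mkord.
  by [].
have Ef : Ex Q f = (l * S)%:R^-1 * \sum_(j < l) \sum_(s < S) Ex Q (Dl (j + ktau)%N s).
  rewrite ExZ ?Ex_sum//; last by apply: intg_sum => j _; exact: isum.
  congr (_ * _); apply: eq_bigr => j _; rewrite Ex_sum// => s.
  exact: iD (leq_addl _ _) (ltn_ord s).
rewrite unlock ExE; last by apply: intgZ; apply: intg_sum => j _; exact: isum.
rewrite ExE; last exact: iphi.
rewrite -EFinB -EFinM lee_fin Ef -/phi -/(phi ktau 0%N).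
have lS0 : 0 < (l * S)%:R :> R by rewrite ltr0n muln_gt0 S0.
have -> : rho * q ^+ 2 / ((l * S)%:R * (mu0 / 2) * b%:R) *
    (Ex Q (phi ktau 0%N) - phi_inf) =
    (l * S)%:R^-1 * (c^-1 * (Ex Q (phi ktau 0%N) - phi_inf)).
  rewrite /c; have := gt_eqF lS0; move: ((l * S)%:R : R) => lS lS1.
  by field; rewrite lS1 !gt_eqF// ltr0n.
rewrite ler_pM2l ?invr_gt0// ler_pdivlMl//.
lra.
Qed.
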